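(* Let $\lambda\in\mathbb{R}\setminus\{0\}$ and $1\le p,q\le\infty$. The space $M_\lambda^{p,q}(\mathbb{R}^{2n})$ is invariant under $\tau_\lambda(\xi)$ and $e_\lambda(\eta)$ for all $\xi,\eta\in\mathbb{R}^{2n}$. When $p=q$ it is invariant under $U_\lambda$.
   Context: Symplectic form on $\mathbb{R}^{2n}$: $[(x,u),(y,v)]=u\cdot y-v\cdot x$. For $\lambda\neq0$, acting on functions on $\mathbb{R}^{2n}$ (and on tempered distributions by duality): twisted translations $\tau_\lambda(\eta)g(\xi)=g(\xi-\eta)e^{-i\frac{\lambda}{2}[\xi,\eta]}$; twisted modulations $e_\lambda(a,b)g(x,u)=g\big(x-\tanh(\tfrac\lambda2)b,\,u+\tanh(\tfrac\lambda2)a\big)e^{-i\frac\lambda2\coth(\frac\lambda2)(x\cdot a+u\cdot b)}$; $\Pi_\lambda(\xi,\eta)=e^{i\frac\lambda2(\coth\lambda)\xi\cdot\eta}e_\lambda(\eta)\tau_\lambda(\xi)$ for $\xi,\eta\in\mathbb{R}^{2n}$; and $U_\lambda g(\xi)=c(\lambda)^n\,\widehat g(c(\lambda)\xi)$ with $c(\lambda)=\tfrac12\lambda\coth(\tfrac12\lambda)$ and $\widehat g(\xi)=(2\pi)^{-n}\int_{\mathbb{R}^{2n}}g(\eta)e^{-i\xi\cdot\eta}d\eta$. The bracket $\langle f,g\rangle$ is linear in $f$, conjugate-linear in $g$, and extends to $f\in\mathcal S'(\mathbb{R}^{2n})$, $g\in\mathcal S(\mathbb{R}^{2n})$. $L^{p,q}(\mathbb{R}^{2n}\times\mathbb{R}^{2n})$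 has norm $\|F\|_{p,q}=\big(\int(\int|F(\xi,\eta)|^pd\xi)^{q/p}d\eta\big)^{1/q}$ (usual modification for $\infty$). The twisted modulation space $M_\lambda^{p,q}(\mathbb{R}^{2n})$ is the space of tempered distributions $f$ on $\mathbb{R}^{2n}$ such that $\langle f,\Pi_\lambda(\xi,\eta)g\rangle\in L^{p,q}(\mathbb{R}^{2n}\times\mathbb{R}^{2n})$ for some nonzero $g\in\mathcal S(\mathbb{R}^{2n})$ (the space does not depend on the choice of $g$). *)

(* Defs.v *)
From HB Require Import structures.
From mathcomp Require Import all_boot all_order all_algebra.
From mathcomp Require Import all_classical all_reals all_analysis.
From mathcomp Require Export complex.

Set Implicit Arguments.
Unset Strict Implicit.
Unset Printing Implicit Defensive.
Import Order.TTheory GRing.Theory Num.Theory.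
Import numFieldNormedType.Exports.

Local Open Scope classical_set_scope.
Local Open Scope complex_scope.
Local Open Scope ring_scope.

(* The sigma-algebra on R^m is the one generated by the coordinates, i.e. the
   product (= Borel) sigma-algebra. *)
Section measurable_rV.
Context {R : realType} (m : nat).

Let coord (i : 'I_m) (v : 'rV[R]_m) : R := v ord0 i.

Let rV_set0 : g_sigma_preimage coord set0.
Proof. exact: sigma_algebra0. Qed.

Let rV_setC A : g_sigma_preimage coord A -> g_sigma_preimage coord (~` A).
Proof. exact: sigma_algebraC. Qed.

Let rV_bigcup (F : (set 'rV[R]_m)^nat) :
  (forall i, g_sigma_preimage coord (F i)) ->
  g_sigma_preimage coord (\bigcup_i (F i)).
Proof. exact: sigma_algebra_bigcup. Qed.

HB.instance Definition _ := @isMeasurable.Build default_measure_display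
  'rV[R]_m (g_sigma_preimage coord) rV_set0 rV_setC rV_bigcup.

End measurable_rV.

Section lebesgue_rV.
Context {R : realType}.

Lemma measurable_coord m (i : 'I_m) :
  measurable_fun [set: 'rV[R]_m] (fun v => v ord0 i).
Proof.
move=> _ Y mY; rewrite setTI; apply: sub_sigma_algebra => /=.
rewrite -bigcup_seq/=; exists i => /=; first by rewrite mem_index_enum.
by exists Y => //; rewrite setTI.
Qed.

Lemma measurable_fun_rV d (T : measurableType d) m (f : T -> 'rV[R]_m) :
  (forall i, measurable_fun setT (fun x => f x ord0 i)) ->
  measurable_fun setT f.
Proof.
move=> mf _ A mA; rewrite setTI.
pose G := [set B : set 'rV[R]_m | measurable (f @^-1` B)].
suff : G A by [].
apply: mA; split.
  split => [|B|F] /=; rewrite /G/=.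
  - by rewrite preimage_set0.
  - by move=> mB; rewrite setTD preimage_setC; exact: measurableC.
  - by move=> mF; rewrite preimage_bigcup; exact: bigcupT_measurable.
rewrite -bigcup_seq => B [i _] [C mC <-].
by rewrite /G/= setTI -comp_preimage -[X in measurable X]setTI; exact: mf.
Qed.

Definition cons_rV k (p : measurableTypeR R * 'rV[R]_k) : 'rV[R]_(1 + k) :=
  row_mx (const_mx p.1) p.2.

Definition uncons_rV k (v : 'rV[R]_(1 + k)) : measurableTypeR R * 'rV[R]_k :=
  (lsubmx v ord0 ord0, rsubmx v).

Lemma cons_rVK k : cancel (@cons_rV k) (@uncons_rV k).
Proof.
by move=> [x v]; rewrite /uncons_rV /cons_rV row_mxKl row_mxKr mxE.
Qed.

Lemma measurable_cons_rV k : measurable_fun setT (@cons_rV k).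
Proof.
apply: measurable_fun_rV => i.
case: (split_ordP i) => j ->.
  under eq_fun do rewrite /cons_rV row_mxEl mxE.
  exact: measurable_fst.
under eq_fun do rewrite /cons_rV row_mxEr.
exact: (measurableT_comp (measurable_coord j) measurable_snd).
Qed.

Lemma measurable_uncons_rV k : measurable_fun setT (@uncons_rV k).
Proof.
apply/measurable_fun_pairP; split.
  rewrite [X in measurable_fun _ X](_ : _ =
    (fun v : 'rV[R]_(1 + k) => v ord0 (lshift k ord0))).
    exact: measurable_coord.
  by apply/funext => v /=; rewrite mxE.
apply: measurable_fun_rV => i.
rewrite [X in measurable_fun _ X](_ : _ =
    (fun v : 'rV[R]_(1 + k) => v ord0 (rshift 1 i))).
  exact: measurable_coord.
by apply/funext => v /=; rewrite mxE.
Qed.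

Section step.
Variables (k : nat) (mu : {sigma_finite_measure set 'rV[R]_k -> \bar R}).

Definition lebesgue_rVS : set 'rV[R]_(1 + k) -> \bar R :=
  pushforward (@lebesgue_measure R \x mu)%E (@cons_rV k).

HB.instance Definition _ := Measure.copy lebesgue_rVS
  (measure_function_pushforward__canonical__measure_function_Measure
     (@lebesgue_measure R \x mu)%E (@measurable_cons_rV k)).

Let lebesgue_rVS_sigma_finite : sigma_finite setT lebesgue_rVS.
Proof.
have /sigma_finiteP[F [FT ndF mF]] := sigma_finiteT (@lebesgue_measure R).
have /sigma_finiteP[G [GT ndG mG]] := sigma_finiteT mu.
exists (fun i => @uncons_rV k @^-1` (F i `*` G i)).
  rewrite -preimage_bigcup (_ : \bigcup_i _ = setT) ?preimage_setT//.
  apply/seteqP; split => // -[x v] _.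
  have [i _ Fi] : (\bigcup_i F i) x by rewrite -FT.
  have [j _ Gj] : (\bigcup_j G j) v by rewrite -GT.
  exists (maxn i j) => //; split.
    by move: x Fi; exact/subsetPset/ndF/leq_maxl.
  by move: v Gj; exact/subsetPset/ndG/leq_maxr.
move=> i; have [mFi Fioo] := mF i; have [mGi Gioo] := mG i.
have mFG : measurable (F i `*` G i) by exact: measurableX.
split; first by rewrite -[X in measurable X]setTI; exact: measurable_uncons_rV.
rewrite /lebesgue_rVS /pushforward -comp_preimage.
rewrite (_ : _ \o _ = id); last by apply/funext => x; exact: cons_rVK.
rewrite preimage_id product_measure1E//.
by rewrite lte_mul_pinfty// ge0_fin_numE.
Qed.

HB.instance Definition _ := Measure_isSigmaFinite.Build _ _ _ lebesgue_rVS
  lebesgue_rVS_sigma_finite.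

End step.

(* Iterated product of the Lebesgue measure on the line; Dirac on R^0. *)
Fixpoint lebesgue_rV (m : nat) : {sigma_finite_measure set 'rV[R]_m -> \bar R} :=
  match m with
  | 0 => \d_(0 : 'rV[R]_0)
  | k.+1 => lebesgue_rVS (lebesgue_rV k)
  end.

End lebesgue_rV.

Section functions.
Context {R : realType}.

Definition dot m (x y : 'rV[R]_m) : R := \sum_(i < m) x ord0 i * y ord0 i.

Definition cosh (t : R) : R := (expR t + expR (- t)) / 2.
Definition sinh (t : R) : R := (expR t - expR (- t)) / 2.
Definition tanh (t : R) : R := sinh t / cosh t.
Definition coth (t : R) : R := cosh t / sinh t.

Definition expi (t : R) : R[i] := cos t +i* sin t.

Definition cmod (z : R[i]) : R := Normc.normc z.

Definition cintegral m (f : 'rV[R]_m -> R[i]) : R[i] :=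
  Rintegral (lebesgue_rV m) setT (fun x => complex.Re (f x)) +i*
  Rintegral (lebesgue_rV m) setT (fun x => complex.Im (f x)).

End functions.

Section schwartz.
Context {R : realType} (m : nat).
Implicit Types (u : 'rV[R]_m -> R) (g : 'rV[R]_m -> R[i]) (s : seq 'I_m).

(* Multi-indices are represented by lists of coordinate directions. *)
Definition partials s u : 'rV[R]_m -> R :=
  foldr (fun i h => fun x => 'D_(delta_mx ord0 i) h x) u s.

Definition smooth u :=
  forall s, (forall x, {for x, continuous (partials s u)}) /\
    (forall i x, derivable (partials s u) x (delta_mx ord0 i)).

Definition csmooth g :=
  smooth (fun x => complex.Re (g x)) /\ smooth (fun x => complex.Im (g x)).

Definition cpartials s g : 'rV[R]_m -> R[i] := fun x =>
  partials s (fun y => complex.Re (g y)) x +i*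
  partials s (fun y => complex.Im (g y)) x.

(* `|x| is the max-norm of matrices, which is equivalent to the Euclidean one. *)
Definition schwartz_seminorm (N : nat) g : \bar R :=
  ereal_sup [set ((1 + `|z.1|) ^+ N * cmod (cpartials z.2 g z.1))%:E
            | z in [set z : 'rV[R]_m * seq 'I_m | (size z.2 <= N)%N]].

Definition schwartz g :=
  csmooth g /\ forall N, (schwartz_seminorm N g < +oo)%E.

(* A distribution is a (complex-)linear functional on functions, of which only
   the values on Schwartz functions are meaningful. A function h corresponds to
   the functional g |-> \int h g. *)
Definition functional := ('rV[R]_m -> R[i]) -> R[i].

Definition tempered (f : functional) :=
  (forall (a : R[i]) g h, schwartz g -> schwartz h ->
     f (fun x => a * g x + h x) = a * f g + f h) /\
  (exists (N : nat) (C : R), forall g, schwartz g ->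
     ((cmod (f g))%:E <= C%:E * schwartz_seminorm N g)%E).

(* <f, g>, linear in f and conjugate-linear in g *)
Definition bracket (f : functional) g : R[i] := f (fun x => conjc (g x)).

(* If S is the formal adjoint of an operator T on functions, i.e.
   <T h, g> = <h, S g>, then T extends to distributions by
   <T f, g> = <f, S g>. *)
Definition ext_by_adjoint (S : ('rV[R]_m -> R[i]) -> 'rV[R]_m -> R[i])
  (f : functional) : functional :=
  fun g => bracket f (S (fun x => conjc (g x))).

End schwartz.

(* A point of R^2n is 'rV_(n + n); (x, u) is row_mx x u. *)

Section twisted.
Context {R : realType} (n : nat) (lam : R).
Local Notation E := 'rV[R]_(n + n).
Implicit Types (xi eta : E) (g : E -> R[i]).

Definition symp xi eta : R :=
  dot (rsubmx xi) (lsubmx eta) - dot (rsubmx eta) (lsubmx xi).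

Definition twisted_translation eta g : E -> R[i] := fun xi =>
  g (xi - eta) * expi (- (lam / 2 * symp xi eta)).

Definition twisted_modulation eta g : E -> R[i] := fun xi =>
  let a := lsubmx eta in let b := rsubmx eta in
  let x := lsubmx xi in let u := rsubmx xi in
  g (row_mx (x - tanh (lam / 2) *: b) (u + tanh (lam / 2) *: a)) *
  expi (- (lam / 2 * coth (lam / 2) * (dot x a + dot u b))).

Definition twisted_shift xi eta g : E -> R[i] := fun zeta =>
  expi (lam / 2 * coth lam * dot xi eta) *
  twisted_modulation eta (twisted_translation xi g) zeta.

Definition fourier g : E -> R[i] := fun xi =>
  (((2 * pi) ^+ n)^-1)%:C * cintegral (fun eta => g eta * expi (- dot xi eta)).

Definition clam : R := lam / 2 * coth (lam / 2).

Definition twisted_fourier g : E -> R[i] := fun xi =>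
  (clam ^+ n)%:C * fourier g (clam *: xi).

(* Extensions to tempered distributions. By a change of variables the adjoint
   of tau_lam(eta) is tau_lam(-eta), that of e_lam(eta) is e_lam(-eta), and, clam
   being real, that of U_lam is g |-> (U_lam g)(- .). *)
Definition dtwisted_translation eta : functional (n + n) -> functional (n + n) :=
  @ext_by_adjoint R _ (twisted_translation (- eta)).

Definition dtwisted_modulation eta : functional (n + n) -> functional (n + n) :=
  @ext_by_adjoint R _ (twisted_modulation (- eta)).

Definition dtwisted_fourier : functional (n + n) -> functional (n + n) :=
  @ext_by_adjoint R _ (fun g xi => twisted_fourier g (- xi)).

End twisted.

Section modulation_space.
Context {R : realType}.

Definition mixed_norm m (p q : \bar R) (F : 'rV[R]_m -> 'rV[R]_m -> R[i]) :
    \bar R :=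
  Lnorm (lebesgue_rV m) q (fun eta =>
    Lnorm (lebesgue_rV m) p (fun xi => (cmod (F xi eta))%:E)).

Definition mixed_Lebesgue m (p q : \bar R)
    (F : 'rV[R]_m -> 'rV[R]_m -> R[i]) :=
  [/\ measurable_fun [set: 'rV[R]_m * 'rV[R]_m]
        (fun z => complex.Re (F z.1 z.2)),
      measurable_fun [set: 'rV[R]_m * 'rV[R]_m]
        (fun z => complex.Im (F z.1 z.2)) &
      (mixed_norm p q F < +oo)%E].

Definition twisted_modulation_space n (lam : R) (p q : \bar R) :
    set (@functional R (n + n)) :=
  [set f | tempered f /\
    exists g, [/\ schwartz g, exists x, g x != 0 &
      mixed_Lebesgue p q
        (fun xi eta => bracket f (twisted_shift lam xi eta g))]].

End modulation_space.

(* Main.v *)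
(* The operators tau_lam and e_lam are, up to phases, translations and
   modulations of R^2n, i.e. Heisenberg operators, which commute up to phases.
   Hence <tau_lam(xi0) f, Pi_lam(xi, eta) tau_lam(xi0) g> and
   <f, Pi_lam(xi, eta) g> have the same modulus, and likewise for e_lam: the
   operator is absorbed in the window.  The Fourier transform exchanges
   translations and modulations, so that the adjoint of U_lam sends
   Pi_lam(xi, eta) g to Pi_lam(eta, -xi) (U_lam^* g) up to a phase; choosing
   g = U_lam g0, Fourier inversion gives
   |<U_lam f, Pi_lam(xi, eta) g>| = K |<f, Pi_lam(eta, -xi) g0>|, and for p = q
   the mixed norm is invariant under this change of variables by Tonelli.

   Fourier inversion is only needed up to an unspecified nonzero constant.  The
   multiplication formula and a dilation yield k(0) \int g^ = g(0) \int k^ for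
   Schwartz g and k, hence \int g^ = C g(0) for some constant C.  If C were 0,
   then \int |g^|^2 = 0, so every Schwartz function would have a vanishing
   Fourier transform, in particular \int |g|^2 = 0. *)
Require Import Defs.
From mathcomp Require Import all_boot all_order all_algebra.
From mathcomp Require Import all_classical all_reals all_analysis.
From mathcomp Require Import measurable_realfun ess_sup_inf.
From mathcomp Require Import ring lra.

Set Implicit Arguments.
Unset Strict Implicit.
Unset Printing Implicit Defensive.
Import Order.TTheory GRing.Theory Num.Theory.
Import numFieldNormedType.Exports.
Local Open Scope classical_set_scope.
Local Open Scope ring_scope.

(** * Lebesgue measure on row vectors *)

(** That the Fourier transform maps the family [twisted_shift] to itself rests on one identity,
    [clam lam * tanh (lam / 2) = lam / 2]: dividing the frequency part of the shift by (xi, eta) by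
    the dilation factor gives exactly the translation part of the shift by (eta, -xi). Membership in
    the space asks for more than a finite norm. The image must be tempered, so every operator needs
    seminorm estimates on Schwartz functions; these come from families of operators closed under
    differentiation, for which sup bounds are enough. The coefficients must also be measurable, so
    the phases have to be explicit functions of (xi, eta) rather than unspecified unimodular
    factors. Limits under the integral sign are taken through explicit rates: each error is one
    integral, bounded by a multiple of a fixed integrable weight. For p infinite, Tonelli does not
    apply to the norm itself, and null superlevel sets take its place. *)

Section lebesgue_rV_theory.
Context {R : realType}.
Local Notation leb := (@lebesgue_measure R).
Local Notation mu := lebesgue_rV.

Lemma ge0_integral_rVS k (f : 'rV[R]_k.+1 -> \bar R) :
  measurable_fun setT f -> (forall x, (0 <= f x)%E) ->
  (\int[mu k.+1]_x f x = \int[leb]_x \int[mu k]_v f (cons_rV (x, v)))%E.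
Proof.
move=> mf f0.
have mfc : measurable_fun setT (f \o @cons_rV R k).
  exact: (measurableT_comp mf (@measurable_cons_rV R k)).
rewrite -(fubini_tonelli1 (f \o @cons_rV R k))//; last by move=> x; exact: f0.
by rewrite (@ge0_integral_pushforward _ _ _ _ _ _ (@measurable_cons_rV R k)).
Qed.

Lemma measurable_rV_norm m : measurable_fun setT (fun x : 'rV[R]_m => `|x|).
Proof.
under eq_fun do rewrite [`|_|]mx_normrE.
elim: (index_enum _) => [|i s ih].
  under eq_fun do rewrite big_nil; exact: measurable_cst.
under eq_fun do rewrite big_cons.
apply: measurable_maxr => //.
have -> : i.1 = ord0 by rewrite ord1.
by apply: measurableT_comp => //; exact: measurable_coord.
Qed.

Lemma measurable_rV_affine m (a : R) (p : 'rV[R]_m) :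
  measurable_fun setT (fun x : 'rV[R]_m => a *: x + p).
Proof.
apply: measurable_fun_rV => i; under eq_fun do rewrite !mxE.
by apply: measurable_funD => //; apply: measurable_funM => //; exact: measurable_coord.
Qed.

Lemma measurable_rV_ball m (p : 'rV[R]_m) r : measurable (ball p r).
Proof.
have m1 : measurable_fun setT (fun x : 'rV[R]_m => `|p - x|).
  have := measurableT_comp (@measurable_rV_norm m) (measurable_rV_affine (-1) p).
  by apply: eq_measurable_fun => x _ /=; rewrite scaleN1r addrC.
rewrite mx_norm_ball /ball_ (_ : [set _ | _] =
  (fun x : 'rV[R]_m => `|p - x|) @^-1` `]-oo, r[%classic).
  by rewrite -[X in measurable X]setTI; apply: m1.
by apply/seteqP; split => x /=; rewrite in_itv.
Qed.

(** The sigma-algebra is generated by the coordinates, so the link with the topology is a covering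
    argument: [U] is the countable union of the balls inside it with rational centre and radius an
    inverse integer. *)
Lemma measurable_rV_open m (U : set 'rV[R]_m) : open U -> measurable U.
Proof.
move=> oU.
pose B (z : 'rV[rat]_m * nat) : set 'rV[R]_m := ball (map_mx (@ratr R) z.1 : 'rV[R]_m) z.2.+1%:R^-1.
have -> : U = \bigcup_(z in [set z | B z `<=` U]) B z.
  apply/seteqP; split => [x Ux|x [z /=]]; last exact.
  have /nbhs_ballP[e /= e0 xeU] : nbhs x U by exact: open_nbhs_nbhs.
  (* A ball of radius below [e / 2] that contains [x] lies in the ball of radius [e] around [x]. *)
  have [k ke] : exists k : nat, k.+1%:R^-1 < e / 2.
    have [k _ /(_ _ (leqnn k))] := near_infty_natSinv_lt (PosNum (divr_gt0 e0 (ltr0n _ 2))).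
    by exists k.
  have /choice[q xq] i : exists q : rat, `|x ord0 i - ratr q| < k.+1%:R^-1.
    have : x ord0 i - k.+1%:R^-1 < x ord0 i + k.+1%:R^-1.
      by rewrite ltrD2l (@lt_trans _ _ 0) // oppr_lt0.
    move=> /rat_in_itvoo[q]; rewrite in_itv/= => qx.
    by exists q; rewrite distrC ltr_distl.
  have xB : B (\row_i q i, k) x.
    split; first by rewrite invr_gt0.
    by move=> i j; rewrite (ord1 i) !mxE/= /ball/= distrC.
  exists (\row_i q i, k) => //= y By.
  apply: xeU; rewrite (_ : e = e / 2 + e / 2); last by lra.
  apply: (@ball_triangle _ _ (map_mx (@ratr R) (\row_i q i))).
    apply: ball_sym; apply: le_ball xB => /=; exact: ltW.
  apply: le_ball By => /=; exact: ltW.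
rewrite (bigcup_mkcond _ _).
apply: countable_bigcupT_measurable; first by [].
move=> z; case: ifP => _ //; exact: measurable_rV_ball.
Qed.

Lemma continuous_measurable_rV m (f : 'rV[R]_m -> R) :
  (forall x, {for x, continuous f}) -> measurable_fun setT f.
Proof.
move=> cf.
apply: (measurability _ (RGenOpens.measurableE R)).
move=> _ [_ [a [b ->] <-]]; rewrite setTI; apply: measurable_rV_open.
by apply: open_comp; [move=> x _; exact: cf|exact: interval_open].
Qed.
End lebesgue_rV_theory.

(** * Affine changes of variables and integrals of products *)

Section lebesgue_rV_affine.
Context {R : realType}.
Local Notation leb := (@lebesgue_measure R).
Local Notation mu := lebesgue_rV.

(** By uniqueness of the Lebesgue measure: its image under the affine map, multiplied by [|a|], has
    the right value on half-open intervals. *)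
Lemma ge0_integral_affine1 (a p : R) (f : R -> \bar R) : a != 0 ->
  measurable_fun [set: R] f -> (forall x, (0 <= f x)%E) ->
  (\int[leb]_x f (a * x + p)%R = (`|a|^-1)%:E * \int[leb]_x f x)%E.
Proof.
move=> a0 mf f0.
have maff : measurable_fun [set: R] (fun x : R => a * x + p : measurableTypeR R).
  by apply: measurable_funD => //; exact: measurable_funM.
have na0 : 0 < `|a| by rewrite normr_gt0.
pose nu := measure_function_mscale__canonical__measure_function_Measure
  (NngNum (ltW na0)) (measure_function_pushforward__canonical__measure_function_Measure leb maff).
have lebE A : measurable A -> leb A = nu A.
  apply: lebesgue_measure_unique => _ [[u v] _ <-] /=.
  rewrite /nu/= /mscale /pushforward.
  (* For negative [a] the preimage of a half-open interval is half-open on the other side, hence the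
     two cases. *)
  move: a0; rewrite neq_lt => /orP[an|ap].
    rewrite [X in (_ * leb X)%E](_ : _ = `[(v - p) / a, (u - p) / a[%classic); last first.
      apply/seteqP; split => x /=; rewrite !in_itv/= => /andP[h1 h2].
        by rewrite ler_ndivrMr// ltr_ndivlMr//; apply/andP; split; lra.
      by move: h1 h2; rewrite ler_ndivrMr// ltr_ndivlMr// => h1 h2; apply/andP; split; lra.
    rewrite !lebesgue_measure_itv/= !lte_fin ltr_ndivrMr// divfK ?lt_eqF// ltrD2r.
    case: ifPn => _; last by rewrite mule0.
    by rewrite -!EFinD -EFinM; congr EFin; rewrite ltr0_norm//; field; rewrite lt_eqF.
  rewrite [X in (_ * leb X)%E](_ : _ = `](u - p) / a, (v - p) / a]%classic); last first.
    apply/seteqP; split => x /=; rewrite !in_itv/= => /andP[h1 h2].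
      by rewrite ler_pdivlMr// ltr_pdivrMr//; apply/andP; split; lra.
    by move: h1 h2; rewrite ler_pdivlMr// ltr_pdivrMr// => h1 h2; apply/andP; split; lra.
  rewrite !lebesgue_measure_itv/= !lte_fin ltr_pdivrMr// divfK ?gt_eqF// ltrD2r.
  case: ifPn => _; last by rewrite mule0.
  by rewrite -!EFinD -EFinM; congr EFin; rewrite gtr0_norm//; field; rewrite gt_eqF.
rewrite [in RHS](eq_measure_integral nu); last by move=> A mA _; exact: lebE.
rewrite /nu ge0_integral_mscale//=.
rewrite [X in (_ = _ * (_ * X))%E](_ : _ = \int[leb]_x f (a * x + p)%R)%E; last first.
  by rewrite (@ge0_integral_pushforward _ _ (measurableTypeR R) (measurableTypeR R) R _ maff leb setT f measurableT mf).
by rewrite muleA -EFinM mulVf ?gt_eqF// mul1e.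
Qed.

Lemma cons_rV_head k (x : R) (v : 'rV[R]_k) : @cons_rV R k (x, v) ord0 (ord0 : 'I_k.+1) = x.
Proof.
rewrite /cons_rV (_ : (ord0 : 'I_(1 + k)) = lshift k ord0) ?row_mxEl ?mxE//.
exact: val_inj.
Qed.

Lemma cons_rV_lift k (x : R) (v : 'rV[R]_k) i :
  @cons_rV R k (x, v) ord0 (lift ord0 i : 'I_k.+1) = v ord0 i.
Proof.
rewrite /cons_rV (_ : (lift ord0 i : 'I_(1 + k)) = rshift 1 i) ?row_mxEr//.
exact: val_inj.
Qed.

(** Induction on the dimension: the head coordinate and the tail are transformed separately, and
    each coordinate contributes one factor [|a|^-1]. *)
Lemma ge0_integral_affine m (a : R) (p : 'rV[R]_m) (f : 'rV[R]_m -> \bar R) :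
  a != 0 -> measurable_fun [set: 'rV[R]_m] f -> (forall x, (0 <= f x)%E) ->
  (\int[mu m]_x f (a *: x + p)%R = (`|a|^-1 ^+ m)%:E * \int[mu m]_x f x)%E.
Proof.
move=> a0; elim: m => [|k ih] in p f * => mf f0.
  by rewrite expr0 mul1e; apply: eq_integral => x _; rewrite [_ + _]thinmx0 [x]thinmx0.
have mfa : measurable_fun [set: 'rV[R]_k.+1] (fun x => f (a *: x + p)).
  exact: (measurableT_comp mf (measurable_rV_affine a p)).
rewrite !ge0_integral_rVS//.
pose p' : 'rV[R]_k := \row_i p ord0 (lift ord0 i).
have E x v : a *: (cons_rV (x, v) : 'rV[R]_k.+1) + p =
    cons_rV (a * x + p ord0 ord0, a *: v + p').
  have aE n (u q : 'rV[R]_n) j : (a *: u + q) ord0 j = a * u ord0 j + q ord0 j.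
    by rewrite !mxE.
  apply/rowP => i; case: (unliftP ord0 i) => [j|] ->.
    by rewrite aE !cons_rV_lift aE mxE.
  by rewrite aE !cons_rV_head.
have mfc : measurable_fun [set: measurableTypeR R * 'rV[R]_k] (f \o @cons_rV R k).
  exact: (measurableT_comp mf (@measurable_cons_rV R k)).
pose G (x : R) := (\int[mu k]_v f (cons_rV (x, v)))%E.
have mG : measurable_fun [set: R] G.
  by apply: (measurable_fun_fubini_tonelli_F (f \o @cons_rV R k)) => // x; exact: f0.
have G0 x : (0 <= G x)%E by exact: integral_ge0.
transitivity (\int[leb]_x ((`|a|^-1 ^+ k)%:E * G (a * x + p ord0 ord0)%R))%E.
  apply: eq_integral => x _; under eq_integral do rewrite E.
  rewrite (ih p' (fun w => f (cons_rV (a * x + p ord0 ord0, w))))//.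
  apply: (measurableT_comp mfc); exact: measurable_pair1.
have maff : measurable_fun [set: R] (fun x : R => a * x + p ord0 ord0 : measurableTypeR R).
  by apply: measurable_funD => //; exact: measurable_funM.
have mGa : measurable_fun [set: measurableTypeR R] (fun x => G (a * x + p ord0 ord0)).
  exact: (@measurableT_comp _ _ _ (measurableTypeR R) (measurableTypeR R) _ G setT _ mG).
transitivity ((`|a|^-1 ^+ k)%:E * \int[leb]_x G (a * x + p ord0 ord0)%R)%E.
  by apply: (@ge0_integralZl _ _ _ leb _ measurableT _ mGa); rewrite ?lee_fin ?exprn_ge0.
by rewrite (ge0_integral_affine1 _ a0 mG)// muleA -EFinM exprSr.
Qed.

(** Reduces to the line both the integrability of the weight below and the positivity of the measure
    of balls. *)
Lemma ge0_integral_prod_rV m (h : 'I_m -> R -> R) :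
  (forall i, measurable_fun [set: R] (h i)) -> (forall i x, 0 <= h i x) ->
  (\int[mu m]_x (\prod_i h i (x ord0 i))%:E = \prod_i \int[leb]_x (h i x)%:E)%E.
Proof.
elim: m h => [|k ih] h mh h0.
  rewrite big_ord0 /=; under eq_integral do rewrite big_ord0.
  by rewrite integral_dirac//= diracT mul1e.
rewrite ge0_integral_rVS; last 2 first.
- apply/measurable_EFinP; apply: measurable_prod => i _.
  exact: measurableT_comp (mh i) (measurable_coord i).
- by move=> x; rewrite lee_fin prodr_ge0.
under eq_integral => x _.
  under eq_integral => v _.
    rewrite big_ord_recl cons_rV_head EFinM.
    under eq_bigr do rewrite cons_rV_lift.
    over.
  rewrite ge0_integralZl//=; last 3 first.
  - apply/measurable_EFinP; apply: measurable_prod => i _.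
    exact: measurableT_comp (mh _) (measurable_coord i).
  - by move=> v _; rewrite lee_fin prodr_ge0.
  - by rewrite lee_fin.
  rewrite (ih (fun i => h (lift ord0 i)))//; over.
rewrite /= ge0_integralZr//; last 3 first.
- by apply/measurable_EFinP; exact: mh.
- by move=> x _; rewrite lee_fin.
- by rewrite prode_ge0// => i _; apply: integral_ge0 => x _; rewrite lee_fin.
by rewrite big_ord_recl.
Qed.
End lebesgue_rV_affine.

(** * An integrable weight, and positivity of the measure on balls *)

Section lebesgue_rV_weight.
Context {R : realType}.
Local Notation leb := (@lebesgue_measure R).
Local Notation mu := lebesgue_rV.

Lemma ler_rV_norm m (x : 'rV[R]_m) i : `|x ord0 i| <= `|x|.
Proof.
rewrite [leRHS]mx_normrE.
by rewrite (@le_bigmax _ _ _ 0 (fun ij : 'I_1 * 'I_m => `|x ij.1 ij.2|) (ord0, i)).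
Qed.

Lemma rV_norm_le m (x : 'rV[R]_m) c : 0 <= c -> (forall i, `|x ord0 i| <= c) -> `|x| <= c.
Proof.
move=> c0 xc; rewrite [leLHS]mx_normrE; apply/bigmax_leP; split => // -[i j] _ /=.
by rewrite (ord1 i).
Qed.

Lemma integral_oneDsqr_lty :
  (\int[leb]_x (((1 + x ^+ 2)^-1)%:E : \bar R) < +oo)%E.
Proof.
pose h (x : R) : \bar R := ((1 + x ^+ 2)^-1)%:E.
have mh : measurable_fun [set: R] h.
  apply/measurable_EFinP; apply: continuous_measurable_fun.
  exact: continuous_oneDsqrV.
have h0 x : (0 <= h x)%E by rewrite lee_fin invr_ge0 addr_ge0// sqr_ge0.
have int0y : (\int[leb]_(x in `[0%R, +oo[) h x < +oo)%E.
  by rewrite /h integral0y_oneDsqr ltry.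
have intNy0 : (\int[leb]_(x in `]-oo, 0%R]) h x < +oo)%E.
  rewrite (_ : (fun x => h x) = (fun x => h (- x))); last first.
    by apply/funext => x; rewrite /h sqrrN.
  by rewrite -ge0_integration_by_substitution0.
rewrite -(setUv `]-oo, 0%R]%classic) ge0_integral_setU//=; last 4 first.
- exact: measurableC.
- by rewrite setUv.
- by move=> x _; exact: h0.
- by apply/disj_set2P; rewrite setICr.
apply: lte_add_pinfty => //; apply: le_lt_trans int0y.
apply: ge0_subset_integral => //.
- exact: measurableC.
- exact: (measurable_funTS mh).
- by move=> x _; exact: h0.
- by move=> x /=; rewrite !in_itv/= andbT => /negP; rewrite -ltNge => /ltW.
Qed.

(** The exponent leaves a factor [(1 + |x|) ^+ 2] per coordinate, which is at least [1 + x_i ^+ 2];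
    so the weight lies below a product of integrable functions of one variable. *)
Definition rV_weight m (x : 'rV[R]_m) : R := ((1 + `|x|) ^+ (m * 2))^-1.

Lemma rV_weight_gt0 m (x : 'rV[R]_m) : 0 < rV_weight x.
Proof. by rewrite invr_gt0 exprn_gt0// ltr_wpDr. Qed.

Lemma measurable_rV_weight m : measurable_fun [set: 'rV[R]_m] (@rV_weight m).
Proof.
apply: continuous_measurable_rV => x.
have cn : (1 + `|y|) @[y --> x] --> (1 + `|x| : R).
  exact: (cvgD (cvg_cst _) (@norm_continuous R 'rV[R]_m x)).
have cX := cvg_comp _ _ cn (@exprn_continuous R (m * 2) (1 + `|x|)).
by apply: (cvgV _ cX); rewrite expf_neq0// gt_eqF// ltr_wpDr.
Qed.

Lemma integrable_rV_weight m :
  (mu m).-integrable [set: 'rV[R]_m] (EFin \o @rV_weight m).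
Proof.
apply/integrableP; split; first by apply/measurable_EFinP; exact: measurable_rV_weight.
pose h (i : 'I_m) (x : R) := (1 + x ^+ 2)^-1.
have h0 i x : 0 <= h i x by rewrite invr_ge0 addr_ge0// sqr_ge0.
have mh i : measurable_fun [set: R] (h i).
  by apply: continuous_measurable_fun => x; exact: (@continuous_oneDsqrV R x).
apply: (@le_lt_trans _ _ (\int[mu m]_x (\prod_i h i (x ord0 i))%:E)%E); last first.
  rewrite ge0_integral_prod_rV//.
  suff /andP[_ //] : (0 <= \prod_(i < m) \int[leb]_x (h i x)%:E < +oo)%E.
  elim/big_ind: _ => [|x y /andP[x0 xoo] /andP[y0 yoo]|i _].
  - by rewrite ltry andbT lee_fin.
  - by rewrite mule_ge0// lte_mul_pinfty// ge0_fin_numE.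
  - by rewrite integral_oneDsqr_lty andbT integral_ge0// => x _; rewrite lee_fin.
apply: ge0_le_integral => //.
- apply/measurable_EFinP; apply: measurableT_comp => //; exact: measurable_rV_weight.
- apply/measurable_EFinP; apply: measurable_prod => i _.
  exact: measurableT_comp (mh i) (measurable_coord i).
move=> x _; rewrite /= lee_fin ger0_norm; last exact/ltW/rV_weight_gt0.
rewrite /rV_weight /h prodfV lef_pV2 ?posrE; last 2 first.
- by rewrite exprn_gt0// ltr_wpDr.
- by rewrite prodr_gt0// => i _; rewrite ltr_wpDr// sqr_ge0.
rewrite mulnC exprM.
have -> : (1 + `|x|) ^+ 2 ^+ m = \prod_(i < m) (1 + `|x|) ^+ 2.
  by rewrite prodr_const card_ord.
apply: ler_prod => i _; rewrite addr_ge0 ?sqr_ge0//=.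
have := ler_rV_norm x i; rewrite -(real_normK (num_real (x ord0 i))).
have := normr_ge0 (x ord0 i); nra.
Qed.

(** Balls of the max-norm are cubes, so their indicator is a product over the coordinates. *)
Lemma lebesgue_rV_ball_gt0 m (p : 'rV[R]_m) r : 0 < r -> (0 < mu m (ball p r))%E.
Proof.
move=> r0.
pose h (i : 'I_m) : R -> R := \1_(ball (p ord0 i) r).
have mh i : measurable_fun [set: R] (h i).
  by apply: measurable_indic; exact: measurable_ball.
rewrite -[mu m _]mul1e -integral_cst; last exact: measurable_rV_ball.
rewrite integral_mkcond.
have -> : (cst 1%E \_ (ball p r))%E = (fun x : 'rV[R]_m => (\prod_i h i (x ord0 i))%:E).
  apply/funext => x; rewrite patchE; case: ifPn => xpr.
    rewrite big1// => i _; rewrite /h indicE mem_set//.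
    by move: xpr; rewrite inE => -[_]; exact.
  have [i xi] : exists i, ~ ball (p ord0 i) r (x ord0 i).
    apply: contrapT => /forallNP h1; move/negP: xpr; apply; rewrite inE.
    by split => // i j; rewrite (ord1 i); exact: contrapT.
  by rewrite (bigD1 i)//= /h indicE memNset// mul0r.
rewrite ge0_integral_prod_rV//.
elim/big_ind: _ => //; first by move=> x y; exact: mule_gt0.
move=> i _; rewrite /h integral_indic//; last exact: measurable_ball.
have lb := @lebesgue_measure_ball R (p ord0 i) r (ltW r0).
by rewrite setIT [ltRHS]lb lte_fin mulrn_wgt0.
Qed.

(** Where [f x] is positive, [f] exceeds [f x / 2] on a ball, and that ball has positive measure. *)
Lemma continuous_integral_eq0 m (f : 'rV[R]_m -> R) :
  (forall x, {for x, continuous f}) -> (forall x, 0 <= f x) ->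
  (\int[mu m]_x (f x)%:E = 0)%E -> forall x, f x = 0.
Proof.
move=> cf f0 intf x; apply/eqP; rewrite eq_le f0 andbT leNgt; apply/negP => fx.
have fx2 : 0 < f x / 2 by rewrite divr_gt0.
have /nbhs_ballP[r /= r0 xr] : nbhs x [set y | f x / 2 < f y].
  have /cvgrPdist_lt/(_ _ fx2) := cf x.
  apply: filterS => y /=; rewrite ltr_norml => /andP[_]; lra.
have : (0 < (f x / 2)%:E * mu m (ball x r))%E.
  by rewrite mule_gt0// lebesgue_rV_ball_gt0.
apply/negP; rewrite -leNgt -intf -integral_cst; last exact: measurable_rV_ball.
have mf := continuous_measurable_rV cf.
apply: (@le_trans _ _ (\int[mu m]_(y in ball x r) (f y)%:E)%E).
  apply: ge0_le_integral => //.
  - exact: measurable_rV_ball.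
  - by move=> y _; rewrite lee_fin ltW.
  - by apply/measurable_EFinP; exact: measurable_funTS.
  - by move=> y xy; rewrite lee_fin ltW//; exact: xr.
apply: ge0_subset_integral => //.
- exact: measurable_rV_ball.
- exact/measurable_EFinP.
- by move=> y _; rewrite lee_fin.
Qed.
End lebesgue_rV_weight.

(** * Complex-valued functions and directional derivatives *)

Section complex_basics.
Local Open Scope complex_scope.
Context {R : realType}.
Implicit Types (z w : R[i]) (t : R).

Lemma cmod_ge0 z : 0 <= cmod z.
Proof. by case: z => a b; exact: sqrtr_ge0. Qed.

Lemma cmodM z w : cmod (z * w) = cmod z * cmod w.
Proof. exact: Normc.normcM. Qed.

Lemma cmodD z w : cmod (z + w) <= cmod z + cmod w.
Proof. exact: le_normcD. Qed.

Lemma cmodN z : cmod (- z) = cmod z.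
Proof. exact: normcN. Qed.

Lemma cmod0 : cmod (0 : R[i]) = 0.
Proof. exact: Normc.normc0. Qed.

Lemma cmod_eq0 z : (cmod z == 0) = (z == 0).
Proof. by apply/eqP/eqP => [/Normc.eq0_normc//|->]; exact: cmod0. Qed.

Lemma cmod_real t : cmod t%:C = `|t|.
Proof. by rewrite /cmod/= expr0n/= addr0 sqrtr_sqr. Qed.

Lemma cmod_conj z : cmod (conjc z) = cmod z.
Proof. by case: z => a b; rewrite /cmod/= sqrrN. Qed.

Lemma Re_le_cmod z : `|complex.Re z| <= cmod z.
Proof.
case: z => a b; rewrite /cmod/= -sqrtr_sqr ler_wsqrtr// lerDl.
exact: sqr_ge0.
Qed.

Lemma Im_le_cmod z : `|complex.Im z| <= cmod z.
Proof.
case: z => a b; rewrite /cmod/= -sqrtr_sqr ler_wsqrtr// lerDr.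
exact: sqr_ge0.
Qed.

Lemma cmod_le z : cmod z <= `|complex.Re z| + `|complex.Im z|.
Proof.
case: z => a b; rewrite /cmod/= -[leRHS]ger0_norm ?addr_ge0//.
rewrite -[leRHS]sqrtr_sqr ler_wsqrtr//.
by rewrite sqrrD !real_normK ?num_real// lerD2r lerDl mulrn_wge0 ?mulr_ge0.
Qed.

Lemma eqC z w : complex.Re z = complex.Re w -> complex.Im z = complex.Im w -> z = w.
Proof. by case: z => a b; case: w => c d /= -> ->. Qed.

Lemma ReD z w : complex.Re (z + w) = complex.Re z + complex.Re w.
Proof. by case: z; case: w. Qed.

Lemma ImD z w : complex.Im (z + w) = complex.Im z + complex.Im w.
Proof. by case: z; case: w. Qed.

Lemma ReM z w :
  complex.Re (z * w) = complex.Re z * complex.Re w - complex.Im z * complex.Im w.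
Proof. by case: z; case: w. Qed.

Lemma ImM z w :
  complex.Im (z * w) = complex.Re z * complex.Im w + complex.Im z * complex.Re w.
Proof. by case: z => a b; case: w => c d /=; rewrite [b * c]mulrC. Qed.

Lemma ReN z : complex.Re (- z) = - complex.Re z.
Proof. by case: z. Qed.

Lemma ImN z : complex.Im (- z) = - complex.Im z.
Proof. by case: z. Qed.

Lemma Re_realM t z : complex.Re (t%:C * z) = t * complex.Re z.
Proof. by rewrite ReM mul0r subr0. Qed.

Lemma Im_realM t z : complex.Im (t%:C * z) = t * complex.Im z.
Proof. by rewrite ImM mul0r addr0. Qed.

Lemma expiD s t : expi (s + t) = expi s * expi t.
Proof.
by apply: eqC; rewrite /= ?cosD// sinD addrC [cos s * _]mulrC [sin s * cos t]mulrC.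
Qed.

Lemma expi0 : expi (0 : R) = 1.
Proof. by rewrite /expi cos0 sin0. Qed.

Lemma conj_expi t : conjc (expi t) = expi (- t).
Proof. by rewrite /expi cosN sinN. Qed.

Lemma cmod_expi t : cmod (expi t) = 1.
Proof. by rewrite /cmod/= cos2Dsin2 sqrtr1. Qed.

Lemma expi_neq0 t : expi t != 0.
Proof. by rewrite -cmod_eq0 cmod_expi oner_eq0. Qed.

End complex_basics.

Section directional_derivatives.
Local Open Scope complex_scope.
Context {R : realType} (m : nat).
Local Notation E := 'rV[R]_m.
Implicit Types (u : E -> R) (f g : E -> R[i]) (x v : E) (i : 'I_m) (s : seq 'I_m).

Lemma is_derive_shift u x p v l :
  is_derive (x - p) v u l -> is_derive x v (fun y => u (y - p)) l.
Proof.
move=> dl.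
have E : (fun h : R => h^-1 *: (((fun y => u (y - p)) \o shift x) (h *: v) - u (x - p))) =
    (fun h : R => h^-1 *: ((u \o shift (x - p)) (h *: v) - u (x - p))).
  by apply/funext => h /=; rewrite addrA.
split.
  by rewrite /derivable E; exact: ex_derive.
by rewrite /derive E; exact: derive_val.
Qed.

(** An explicit second-order remainder is the form in which the derivatives of phases and of Fourier
    integrals are obtained later. *)
Lemma is_derive_quadratic u x v l K :
  (forall h : R, `|u (h *: v + x) - u x - h * l| <= K * h ^+ 2) ->
  is_derive x v u l.
Proof.
move=> uK.
have K0 : 0 <= K by have := uK 1; rewrite expr1n mulr1; exact: le_trans.
have cl : (fun h : R => h^-1 *: ((u \o shift x) (h *: v) - u x)) @ 0^' --> l.
  apply/cvgrPdist_le => e e0; near=> h.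
  have h0 : h != 0 by near: h; exact: nbhs_dnbhs_neq.
  rewrite distrC -(@ler_pM2l _ `|h|) ?normr_gt0// -normrM mulrBr.
  rewrite /= [_ *: _]/(_ * _) mulrA divff// mul1r.
  apply: le_trans (uK h) _.
  rewrite -(real_normK (num_real h)) expr2 mulrCA ler_pM2l ?normr_gt0//.
  have hK : `|h| <= e / (K + 1).
    near: h; apply: dnbhs0_le; rewrite divr_gt0//; lra.
  rewrite (le_trans (ler_wpM2l K0 hK))// mulrCA -[leRHS]mulr1 ler_pM2l//.
  rewrite ler_pdivrMr; lra.
split; first by apply/cvg_ex; exists l.
exact: cvg_lim cl.
Unshelve. all: by end_near. Qed.

(** Componentwise, to match [csmooth] and [cpartials], which treat real and imaginary parts as
    separate real functions. *)
Definition cis_derive v g x d :=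
  is_derive x v (fun y => complex.Re (g y)) (complex.Re d) /\
  is_derive x v (fun y => complex.Im (g y)) (complex.Im d).

Lemma cis_derive_eq v g x d d' : cis_derive v g x d -> d = d' -> cis_derive v g x d'.
Proof. by move=> ? <-. Qed.

Lemma cis_deriveD v f g x df dg : cis_derive v f x df -> cis_derive v g x dg ->
  cis_derive v (fun y => f y + g y) x (df + dg).
Proof.
move=> [f1 f2] [g1 g2]; split.
  rewrite ReD (_ : (fun y => _) = (fun y => complex.Re (f y)) + (fun y => complex.Re (g y))).
    exact: is_deriveD.
  by apply/funext => y; rewrite ReD.
rewrite ImD (_ : (fun y => _) = (fun y => complex.Im (f y)) + (fun y => complex.Im (g y))).
  exact: is_deriveD.
by apply/funext => y; rewrite ImD.
Qed.

Lemma cis_deriveM v f g x df dg : cis_derive v f x df -> cis_derive v g x dg ->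
  cis_derive v (fun y => f y * g y) x (df * g x + f x * dg).
Proof.
move=> [f1 f2] [g1 g2]; split.
  rewrite (_ : (fun y => _) = (fun y => complex.Re (f y)) * (fun y => complex.Re (g y))
    - (fun y => complex.Im (f y)) * (fun y => complex.Im (g y))); last first.
    by apply/funext => y; rewrite ReM.
  apply: is_derive_eq (is_deriveB (is_deriveM f1 g1) (is_deriveM f2 g2)) _.
  by rewrite ReD !ReM /GRing.scale/=; ring.
rewrite (_ : (fun y => _) = (fun y => complex.Re (f y)) * (fun y => complex.Im (g y))
    + (fun y => complex.Im (f y)) * (fun y => complex.Re (g y))); last first.
  by apply/funext => y; rewrite ImM.
apply: is_derive_eq (is_deriveD (is_deriveM f1 g2) (is_deriveM f2 g1)) _.
by rewrite ImD !ImM /GRing.scale/=; ring.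
Qed.

Lemma cis_derive_cst v c x : cis_derive v (fun=> c) x 0.
Proof.
by split; exact: is_derive_cst.
Qed.

Lemma cis_derive_conj v g x d : cis_derive v g x d ->
  cis_derive v (fun y => conjc (g y)) x (conjc d).
Proof.
move=> [g1 g2]; split.
  have -> : (fun y => complex.Re (conjc (g y))) = (fun y => complex.Re (g y)).
    by apply/funext => y; case: (g y).
  by case: d g1 {g2}.
rewrite (_ : (fun y => _) = - (fun y => complex.Im (g y))); last first.
  by apply/funext => y; rewrite fctE; case: (g y).
apply: is_derive_eq.

by case: d {g1 g2}.
Qed.

Lemma cis_derive_shift v g x p d : cis_derive v g (x - p) d ->
  cis_derive v (fun y => g (y - p)) x d.
Proof. by move=> [g1 g2]; split; exact: is_derive_shift. Qed.

Definition ebasis i : E := delta_mx ord0 i.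

Definition cderiv i g x : R[i] :=
  'D_(ebasis i) (fun y => complex.Re (g y)) x +i*
  'D_(ebasis i) (fun y => complex.Im (g y)) x.

Lemma cis_derive_cderiv i g x d : cis_derive (ebasis i) g x d -> cderiv i g x = d.
Proof.
by move=> [g1 g2]; apply: eqC; rewrite /cderiv/=; exact: derive_val.
Qed.

Definition ccontinuous g :=
  (forall x, {for x, continuous (fun y => complex.Re (g y))}) /\
  (forall x, {for x, continuous (fun y => complex.Im (g y))}).

Lemma eq_forall_continuous (u u' : E -> R) : u =1 u' ->
  (forall x, {for x, continuous u}) -> forall x, {for x, continuous u'}.
Proof. by move=> /funext ->. Qed.

Lemma ccontinuousD f g : ccontinuous f -> ccontinuous g ->
  ccontinuous (fun y => f y + g y).
Proof.
move=> [f1 f2] [g1 g2]; split.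
  apply: eq_forall_continuous => [y|x]; first exact/esym/ReD.
  exact: (continuousD (f1 x) (g1 x)).
apply: eq_forall_continuous => [y|x]; first exact/esym/ImD.
exact: (continuousD (f2 x) (g2 x)).
Qed.

Lemma ccontinuousM f g : ccontinuous f -> ccontinuous g ->
  ccontinuous (fun y => f y * g y).
Proof.
move=> [f1 f2] [g1 g2]; split.
  apply: eq_forall_continuous => [y|x]; first exact/esym/ReM.
  exact: (continuousB (continuousM (f1 x) (g1 x)) (continuousM (f2 x) (g2 x))).
apply: eq_forall_continuous => [y|x]; first exact/esym/ImM.
exact: (continuousD (continuousM (f1 x) (g2 x)) (continuousM (f2 x) (g1 x))).
Qed.

Lemma ccontinuous_cst c : ccontinuous (fun=> c).
Proof. by split => x; exact: cst_continuous. Qed.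

Lemma ccontinuous_conj g : ccontinuous g -> ccontinuous (fun y => conjc (g y)).
Proof.
move=> [g1 g2]; split.
  by apply: eq_forall_continuous g1 => y; case: (g y).
apply: (@eq_forall_continuous (fun y => - complex.Im (g y))) => [y|x].
  by case: (g y).
exact: (continuousN (g2 x)).
Qed.

Lemma ccontinuous_shift g p : ccontinuous g -> ccontinuous (fun y => g (y - p)).
Proof.
have cs x : {for x, continuous (fun y : E => y - p)}.
  exact: (@cvgB R E E (nbhs x) _ id (fun=> p) x p (@cvg_id _ (nbhs x)) (cvg_cst p)).
move=> [g1 g2]; split => x.
  exact: (continuous_comp (cs x) (g1 (x - p))).
exact: (continuous_comp (cs x) (g2 (x - p))).
Qed.

Lemma csmoothP g : csmooth g <->
  forall s, ccontinuous (cpartials s g) /\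
    forall i x, cis_derive (ebasis i) (cpartials s g) x (cpartials (i :: s) g x).
Proof.
split=> [[g1 g2] s|gs].
  have [c1 d1] := g1 s; have [c2 d2] := g2 s.
  split; first by split.
  move=> i x; split; exact/DeriveDef.
split=> s; have [[c1 c2] d] := gs s.
  by split; [exact: c1|move=> i x; have [[d1 _] _] := d i x].
by split; [exact: c2|move=> i x; have [_ [d2 _]] := d i x].
Qed.

End directional_derivatives.

(** * Continuous operators on the Schwartz space *)

Section schwartz_operators.
Local Open Scope complex_scope.
Context {R : realType} (m : nat).
Local Notation E := 'rV[R]_m.
Local Notation op := ((E -> R[i]) -> E -> R[i]).
Implicit Types (f g h phi : E -> R[i]) (x p q : E) (i : 'I_m) (s : seq 'I_m).
Implicit Types (T A B : op).

(** [fine] sends an infinite seminorm to 0, so this value is faithful only where the seminorm is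
    finite, in particular on Schwartz functions. *)
Definition snorm N g : R := fine (schwartz_seminorm N g).

Lemma weight_ge1 (x : E) : 1 <= 1 + `|x|.
Proof. by rewrite lerDl. Qed.

Lemma le_weightX (x : E) (k l : nat) : (k <= l)%N -> (1 + `|x|) ^+ k <= (1 + `|x|) ^+ l.
Proof. by move=> kl; rewrite ler_weXn2l// weight_ge1. Qed.

Lemma weightX_ge0 (x : E) k : 0 <= (1 + `|x|) ^+ k.
Proof. by rewrite exprn_ge0// addr_ge0. Qed.

Lemma schwartz_seminorm_ge0 N g : (0 <= schwartz_seminorm N g)%E.
Proof.
apply: (@le_trans _ _ (((1 + `|0 : E|) ^+ N * cmod (cpartials [::] g 0))%:E)).
  by rewrite lee_fin mulr_ge0 ?weightX_ge0 ?cmod_ge0.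
by apply: ereal_sup_ubound; exists (0, [::]).
Qed.

Lemma snorm_ge0 N g : 0 <= snorm N g.
Proof. exact/fine_ge0/schwartz_seminorm_ge0. Qed.

Lemma schwartz_seminormE N g : schwartz g -> schwartz_seminorm N g = (snorm N g)%:E.
Proof.
move=> [_ /(_ N) gN]; rewrite fineK// ge0_fin_numE//.
exact: schwartz_seminorm_ge0.
Qed.

Lemma schwartz_bound N g s x : schwartz g -> (size s <= N)%N ->
  (1 + `|x|) ^+ N * cmod (cpartials s g x) <= snorm N g.
Proof.
move=> gS sN; rewrite -lee_fin -schwartz_seminormE//.
by apply: ereal_sup_ubound; exists (x, s).
Qed.

Lemma schwartz_seminorm_le N g C :
  (forall s x, (size s <= N)%N -> (1 + `|x|) ^+ N * cmod (cpartials s g x) <= C) ->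
  (schwartz_seminorm N g <= C%:E)%E.
Proof.
move=> gC; apply: ge_ereal_sup => _ [[x s] /= sN <-].
by rewrite lee_fin gC.
Qed.

Lemma snorm_le N g C :
  (forall s x, (size s <= N)%N -> (1 + `|x|) ^+ N * cmod (cpartials s g x) <= C) ->
  snorm N g <= C.
Proof.
move=> /schwartz_seminorm_le gC; rewrite -lee_fin fineK// ge0_fin_numE.
  exact: le_lt_trans gC (ltry _).
exact: schwartz_seminorm_ge0.
Qed.

Lemma schwartz_intro g : csmooth g ->
  (forall N, exists C, forall s x, (size s <= N)%N ->
    (1 + `|x|) ^+ N * cmod (cpartials s g x) <= C) -> schwartz g.
Proof.
move=> gs gN; split => // N; have [C gC] := gN N.
by apply: le_lt_trans (schwartz_seminorm_le gC) _; rewrite ltry.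
Qed.

Lemma snorm_mono N N' g : schwartz g -> (N <= N')%N -> snorm N g <= snorm N' g.
Proof.
move=> gS NN'; apply: snorm_le => s x sN.
apply: le_trans (schwartz_bound x gS (leq_trans sN NN')).
by rewrite ler_wpM2r ?cmod_ge0// le_weightX.
Qed.

(** The head of the list is the outermost derivative and the last entry the innermost. Smoothness
    peels off the head, whereas seminorms of a derivative need the last entry. *)
Lemma cpartials_rcons s i g : cpartials (rcons s i) g = cpartials s (cderiv i g).
Proof. by apply/funext => x; rewrite /cpartials/partials !foldr_rcons. Qed.

Lemma schwartz_cis_derive g : schwartz g ->
  forall s i x, cis_derive (ebasis i) (cpartials s g) x (cpartials (i :: s) g x).
Proof. by move=> [/csmoothP gs _] s; have [] := gs s. Qed.

Lemma cpartials_nil g : cpartials [::] g = g.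
Proof. by apply/funext => x; apply: eqC. Qed.

Lemma schwartz_cis_derive0 g : schwartz g ->
  forall i x, cis_derive (ebasis i) g x (cderiv i g x).
Proof. by move=> gS i x; have := schwartz_cis_derive gS [::] i x; rewrite cpartials_nil. Qed.

Lemma schwartz_ccontinuous g : schwartz g -> ccontinuous g.
Proof. by move=> [/csmoothP/(_ [::])[+ _] _]; rewrite cpartials_nil. Qed.

(** Continuity of [T] on the Schwartz space. A single seminorm on the right is enough because the
    seminorms increase with their index ([snorm_mono]). *)
Definition sop T := (forall g, schwartz g -> schwartz (T g)) /\
  forall N, exists N' C, 0 <= C /\
    forall g, schwartz g -> snorm N (T g) <= C * snorm N' g.

Definition pointwise_bounded T := forall N, exists N' C, 0 <= C /\
  forall g, schwartz g -> forall x, (1 + `|x|) ^+ N * cmod (T g x) <= C * snorm N' g.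

(* A family of operators that is stable under differentiation inherits from its
   sup bounds the bounds on all derivatives. *)
Lemma sop_family (F : op -> Prop) :
  (forall T, F T -> forall g, schwartz g -> ccontinuous (T g)) ->
  (forall T, F T -> forall i, exists T', F T' /\
    forall g, schwartz g -> forall x, cis_derive (ebasis i) (T g) x (T' g x)) ->
  (forall T, F T -> pointwise_bounded T) ->
  forall T, F T -> sop T.
Proof.
move=> Fc Fd Fb.
have Fp s T : F T -> exists T', F T' /\
    forall g, schwartz g -> cpartials s (T g) = T' g.
  move=> FT; elim: s => [|i s [T' [FT' T'E]]].
    by exists T; split => // g _; rewrite cpartials_nil.
  have [T'' [FT'' T''E]] := Fd _ FT' i; exists T''; split => // g gS.
  apply/funext => x; rewrite -[LHS]/(cderiv i (cpartials s (T g)) x) T'E//.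
  exact/cis_derive_cderiv/T''E.
have Fs T g : F T -> schwartz g -> csmooth (T g).
  move=> FT gS; apply/csmoothP => s.
  have [T' [FT' T'E]] := Fp s _ FT; rewrite T'E//; split; first exact: Fc.
  move=> i x; have [T'' [_ /(_ _ gS x)]] := Fd _ FT' i => d.
  rewrite (_ : cpartials (i :: s) (T g) x = T'' g x)//.
  rewrite -[LHS]/(cderiv i (cpartials s (T g)) x) T'E//.
  exact: cis_derive_cderiv.
(* Induction on the order [k] for all members at once: the innermost derivative of [T g] is [D i g]
   for another member [D i], to which the bound of order [k] applies. A maximum and a sum over the
   finitely many directions make the constants independent of [i]. *)
have Fbs k : forall N T, F T -> exists N' C, 0 <= C /\
    forall g, schwartz g -> forall s x, (size s <= k)%N ->
      (1 + `|x|) ^+ N * cmod (cpartials s (T g) x) <= C * snorm N' g.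
  elim: k => [|k ih] N T FT.
    have [N' [C [C0 TC]]] := Fb _ FT N; exists N', C; split => // g gS s x.
    by rewrite leqn0 => /nilP ->; rewrite cpartials_nil; exact: TC.
  have /choice[D DE] := Fd _ FT.
  have /choice[M ME] i := ih N _ (DE i).1.
  have /choice[c cE] := ME.
  have [N0 [C0 [C00 TC0]]] := Fb _ FT N.
  exists (maxn N0 (\max_i M i)), (C0 + \sum_i c i).
  have sc0 : 0 <= \sum_i c i by apply: sumr_ge0 => i _; exact: (cE i).1.
  split=> [|g gS s x]; first exact: addr_ge0.
  case/lastP: s => [_|s i].
    rewrite cpartials_nil (le_trans (TC0 _ gS x))// ler_pM ?snorm_ge0 ?lerDl//.
    by apply: snorm_mono => //; exact: leq_maxl.
  rewrite size_rcons ltnS => sk; rewrite cpartials_rcons.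
  have -> : cderiv i (T g) = D i g.
    by apply/funext => y; apply: cis_derive_cderiv; exact: (DE i).2.
  have [ci0 /(_ _ gS s x sk) ciE] := cE i.
  rewrite (le_trans ciE)// ler_pM ?snorm_ge0//.
    rewrite (bigD1 i)//= addrCA lerDl addr_ge0//.
    by apply: sumr_ge0 => j _; exact: (cE j).1.
  apply: snorm_mono => //; rewrite leq_max; apply/orP; right.
  exact: (leq_bigmax_cond i).
move=> T FT; split=> [g gS|N].
  apply: schwartz_intro; first exact: Fs.
  move=> N; have [N' [C [_ TC]]] := Fbs N N _ FT.
  by exists (C * snorm N' g) => s x; exact: TC.
have [N' [C [C0 TC]]] := Fbs N N _ FT; exists N', C; split => // g gS.
by apply: snorm_le => s x; exact: TC.
Qed.

Lemma sop_pointwise_bounded T : sop T -> pointwise_bounded T.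
Proof.
move=> [TS Tb] N; have [N' [C [C0 TC]]] := Tb N; exists N', C; split => // g gS x.
apply: le_trans (TC _ gS).
by have := @schwartz_bound N _ [::] x (TS _ gS) (leq0n _); rewrite cpartials_nil.
Qed.

Lemma sop_comp A B : sop A -> sop B -> sop (fun g => A (B g)).
Proof.
move=> [AS Ab] [BS Bb]; split=> [g /BS/AS//|N].
have [N' [C [C0 AC]]] := Ab N; have [N'' [D [D0 BD]]] := Bb N'.
exists N'', (C * D); split=> [|g gS]; first exact: mulr_ge0.
rewrite -mulrA (le_trans (AC _ (BS _ gS)))// ler_wpM2l//.
exact: BD.
Qed.

Lemma sop_id : sop id.
Proof. by split=> // N; exists N, 1; split => // g _; rewrite mul1r. Qed.

Lemma sop_cderiv i : sop (cderiv i).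
Proof.
have pE s g : cpartials s (cderiv i g) = cpartials (rcons s i) g.
  by rewrite cpartials_rcons.
have B N g s x : schwartz g -> (size s <= N)%N ->
    (1 + `|x|) ^+ N * cmod (cpartials s (cderiv i g) x) <= snorm N.+1 g.
  move=> gS sN; rewrite pE.
  apply: le_trans (@schwartz_bound N.+1 _ (rcons s i) x gS _).
    by rewrite ler_wpM2r ?cmod_ge0 ?le_weightX.
  by rewrite size_rcons.
split=> [g gS|N].
  apply: schwartz_intro => [|N]; last by exists (snorm N.+1 g) => s x; exact: B.
  apply/csmoothP => s; have [/csmoothP/(_ (rcons s i))[gc gd] _] := gS.
  rewrite pE; split => // j x.
  by rewrite pE; exact: gd.
exists N.+1, 1; split=> // g gS; rewrite mul1r.
by apply: snorm_le => s x; exact: B.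
Qed.

(** The multipliers of the Schwartz space, usually written O_M. *)
Definition slow phi := csmooth phi /\
  forall s, exists N C, 0 <= C /\ forall x, cmod (cpartials s phi x) <= C * (1 + `|x|) ^+ N.

Lemma slow_cderiv phi i : slow phi -> slow (cderiv i phi).
Proof.
move=> [/csmoothP phis phib]; split => [|s].
  apply/csmoothP => s; have [c d] := phis (rcons s i).
  rewrite -cpartials_rcons; split => // j x.
  by rewrite -cpartials_rcons; exact: d.
by rewrite -cpartials_rcons.
Qed.

(** The counterpart of [sop_family] for multipliers: in a family closed under differentiation,
    growth of the functions themselves controls all derivatives. *)
Lemma slow_family (F : (E -> R[i]) -> Prop) :
  (forall phi, F phi -> ccontinuous phi) ->
  (forall phi, F phi -> forall i, exists psi, F psi /\
    forall x, cis_derive (ebasis i) phi x (psi x)) ->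
  (forall phi, F phi -> exists N C, 0 <= C /\
    forall x, cmod (phi x) <= C * (1 + `|x|) ^+ N) ->
  forall phi, F phi -> slow phi.
Proof.
move=> Fc Fd Fb phi Fphi.
have Fp s : F (cpartials s phi).
  elim: s => [|i s ih]; first by rewrite cpartials_nil.
  have [psi [Fpsi psiE]] := Fd _ ih i.
  rewrite (_ : cpartials (i :: s) phi = psi)//; apply/funext => x.
  exact: cis_derive_cderiv (psiE x).
split=> [|s]; last exact: Fb.
apply/csmoothP => s; split; first exact: Fc.
move=> i x; have [psi [Fpsi psiE]] := Fd _ (Fp s) i.
by rewrite -[cpartials (i :: s) phi x]/(cderiv i (cpartials s phi) x) (cis_derive_cderiv (psiE x)).
Qed.

Lemma slow_cis_derive phi : slow phi ->
  forall i x, cis_derive (ebasis i) phi x (cderiv i phi x).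
Proof.
by move=> [/csmoothP/(_ [::])[_ d] _] i x; have := d i x; rewrite cpartials_nil.
Qed.

Lemma slow_ccontinuous phi : slow phi -> ccontinuous phi.
Proof. by move=> [/csmoothP/(_ [::])[+ _] _]; rewrite cpartials_nil. Qed.

Lemma slow_schwartz g : schwartz g -> slow g.
Proof.
move=> gS; split=> [|s]; first by case: gS.
exists 0, (snorm (size s) g); split=> [|x]; first exact: snorm_ge0.
rewrite expr0 mulr1; apply: le_trans (schwartz_bound x gS (leqnn _)).
by rewrite ler_peMl ?cmod_ge0// exprn_ege1// weight_ge1.
Qed.

(** Products are not closed under differentiation, but by the Leibniz rule finite sums of products
    are. *)
Inductive mul_family : op -> Prop :=
| mul_family_mul A phi : sop A -> slow phi -> mul_family (fun g x => A g x * phi x)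
| mul_family_add A B : mul_family A -> mul_family B ->
    mul_family (fun g x => A g x + B g x).

Lemma mul_family_sop T : mul_family T -> sop T.
Proof.
apply: sop_family T => T.
- elim=> [A phi [AS _] phis g gS|A B _ Ac _ Bc g gS].
    by apply: ccontinuousM; [exact/schwartz_ccontinuous/AS|exact: slow_ccontinuous].
  by apply: ccontinuousD; [exact: Ac|exact: Bc].
- elim=> [A phi As phis i|A B _ Ad _ Bd i].
    exists (fun g x => cderiv i (A g) x * phi x + A g x * cderiv i phi x); split.
      apply: mul_family_add.
        by apply: mul_family_mul => //; exact: (sop_comp (sop_cderiv i) As).
      by apply: mul_family_mul => //; exact: slow_cderiv.
    move=> g gS x; apply: cis_deriveM; last exact: slow_cis_derive.
    by apply: schwartz_cis_derive0; exact: As.1.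
  have [A' [FA' AE]] := Ad i; have [B' [FB' BE]] := Bd i.
  exists (fun g x => A' g x + B' g x); split; first exact: mul_family_add.
  by move=> g gS x; apply: cis_deriveD; [exact: AE|exact: BE].
elim=> [A phi As [_ phib] N|A B _ Ab _ Bb N].
  have [M [C [C0 phiC]]] := phib [::]; rewrite cpartials_nil in phiC.
  (* The [M] extra powers of the weight pay for the growth of [phi]. *)
  have [N' [D [D0 AD]]] := sop_pointwise_bounded As (N + M).
  exists N', (C * D); split=> [|g gS x]; first exact: mulr_ge0.
  rewrite -mulrA; apply: le_trans (ler_wpM2l C0 (AD _ gS x)).
  rewrite cmodM exprD mulrA.
  have := ler_wpM2l (mulr_ge0 (weightX_ge0 x N) (cmod_ge0 (A g x))) (phiC x).
  move=> /le_trans; apply; rewrite le_eqVlt; apply/orP; left; apply/eqP; ring.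
have [N1 [C1 [C10 AC]]] := Ab N; have [N2 [C2 [C20 BC]]] := Bb N.
exists (maxn N1 N2), (C1 + C2); split=> [|g gS x]; first exact: addr_ge0.
apply: (le_trans (ler_wpM2l (weightX_ge0 x N) (cmodD _ _))).
rewrite mulrDr mulrDl lerD//.
  by apply: le_trans (AC _ gS x) _; rewrite ler_wpM2l// snorm_mono// leq_maxl.
by apply: le_trans (BC _ gS x) _; rewrite ler_wpM2l// snorm_mono// leq_maxr.
Qed.

Lemma sop_mul phi : slow phi -> sop (fun g x => phi x * g x).
Proof.
move=> phis; have := mul_family_sop (mul_family_mul sop_id phis).
by rewrite (_ : (fun g x => id g x * phi x) = (fun g x => phi x * g x))//;
  apply/funext => g; apply/funext => x; rewrite mulrC.
Qed.

Lemma slow_cst c : slow (fun=> c : R[i]).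
Proof.
apply: (@slow_family (fun phi => exists c, phi = fun=> c)); last by exists c.
- by move=> _ [d ->]; exact: ccontinuous_cst.
- move=> _ [d ->] i; exists (fun=> 0); split; first by exists 0.
  by move=> x; exact: cis_derive_cst.
- move=> _ [d ->]; exists 0, (cmod d); split=> [|x]; first exact: cmod_ge0.
  by rewrite expr0 mulr1.
Qed.

Lemma sop_scale c : sop (fun g x => c * g x).
Proof. exact/sop_mul/slow_cst. Qed.

Lemma sop_shift p : sop (fun g x => g (x - p)).
Proof.
apply: (@sop_family (fun T => exists A, sop A /\ T = fun g x => A g (x - p))); last first.
  by exists id; split => //; exact: sop_id.
- move=> _ [A [As ->]] N; have [N' [C [C0 AC]]] := sop_pointwise_bounded As N.
  (* The constant comes from [1 + |x| <= (1 + |p|) * (1 + |x - p|)]. *)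
  exists N', ((1 + `|p|) ^+ N * C); split=> [|g gS x].
    by rewrite mulr_ge0 ?weightX_ge0.
  rewrite -mulrA; apply: le_trans (ler_wpM2l (weightX_ge0 p N) (AC _ gS (x - p))).
  rewrite mulrA -exprMn ler_wpM2r ?cmod_ge0// lerXn2r ?nnegrE ?mulr_ge0 ?addr_ge0//.
  have := ler_normD (x - p) p; rewrite subrK.
  have := mulr_ge0 (normr_ge0 p) (normr_ge0 (x - p)); lra.
- move=> _ [A [As ->]] i; exists (fun g x => cderiv i (A g) (x - p)); split.
    by exists (fun g => cderiv i (A g)); split => //; exact: sop_comp (sop_cderiv i) As.
  move=> g gS x; apply: cis_derive_shift.
  by apply: schwartz_cis_derive0; exact: As.1.
- move=> _ [A [As ->]] g gS; apply: ccontinuous_shift.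
  by apply: schwartz_ccontinuous; exact: As.1.
Qed.

Lemma sop_conj : sop (fun g x => conjc (g x)).
Proof.
apply: (@sop_family (fun T => exists A, sop A /\ T = fun g x => conjc (A g x))); last first.
  by exists id; split => //; exact: sop_id.
- move=> _ [A [As ->]] N; have [N' [C [C0 AC]]] := sop_pointwise_bounded As N.
  by exists N', C; split => // g gS x; rewrite cmod_conj; exact: AC.
- move=> _ [A [As ->]] i; exists (fun g x => conjc (cderiv i (A g) x)); split.
    by exists (fun g => cderiv i (A g)); split => //; exact: sop_comp (sop_cderiv i) As.
  move=> g gS x; apply: cis_derive_conj.
  by apply: schwartz_cis_derive0; exact: As.1.
- move=> _ [A [As ->]] g gS; apply: ccontinuous_conj.
  by apply: schwartz_ccontinuous; exact: As.1.
Qed.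

Lemma schwartz0 : schwartz ((fun=> 0) : E -> R[i]).
Proof.
apply: schwartz_intro; first exact: (slow_cst 0).1.
move=> N; exists 0 => s x _.
suff -> : cpartials s (fun=> 0) = ((fun=> 0) : E -> R[i]) by rewrite cmod0 mulr0.
elim: s => [|i s ih]; first by rewrite cpartials_nil.
rewrite -[cpartials _ _]/(cderiv i (cpartials s (fun=> 0))) ih; apply/funext => y.
exact/cis_derive_cderiv/cis_derive_cst.
Qed.

Lemma schwartz_lin (a : R[i]) g h : schwartz g -> schwartz h ->
  schwartz (fun x => a * g x + h x).
Proof.
move=> gS0 hS; have := (sop_scale a).1 _ gS0.
(* The scalar is absorbed into [g], which leaves a plain sum to treat. *)
rewrite -[fun x => a * g x + h x]/(fun x => (fun y => a * g y) x + h x).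
move: (fun y => a * g y) => {gS0}g gS.
have E s : cpartials s (fun x => g x + h x) = (fun x => cpartials s g x + cpartials s h x).
  elim: s => [|i s ih]; first by rewrite !cpartials_nil.
  apply/funext => x.
  rewrite -[LHS]/(cderiv i (cpartials s (fun x => g x + h x)) x) ih; apply: cis_derive_cderiv.
  by apply: cis_deriveD; exact: schwartz_cis_derive.
apply: schwartz_intro => [|N].
  have [/csmoothP gs _] := gS; have [/csmoothP hs _] := hS.
  apply/csmoothP => s; rewrite E; have [gc gd] := gs s; have [hc hd] := hs s.
  split=> [|i x]; first exact: ccontinuousD.
  by rewrite E; exact: cis_deriveD.
exists (snorm N g + snorm N h) => s x sN; rewrite E.
apply: (le_trans (ler_wpM2l (weightX_ge0 x N) (cmodD _ _))).
by rewrite mulrDr lerD// schwartz_bound.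
Qed.

End schwartz_operators.

(** * Heisenberg operators *)

Section mean_value.
Local Open Scope complex_scope.
Context {R : realType}.

Lemma mean_value_le (u du : R -> R) (t K : R) :
  (forall s : R, is_derive s 1 u (du s)) -> (forall s, `|s| <= `|t| -> `|du s| <= K) ->
  `|u t - u 0| <= K * `|t|.
Proof.
move=> udu duK.
have uc (a b : R) : {within `[a, b], continuous u}.
  by apply: derivable_within_continuous => s _; exact: ex_derive.
have [t0|t0] := leP 0 t.
  have [c] := MVT_segment t0 (fun s _ => udu s) (uc _ _).
  rewrite in_itv/= => /andP[c0 ct] ->.
  rewrite normrM subr0 ler_wpM2r// duK//.
  by rewrite !ger0_norm.
have [c] := MVT_segment (ltW t0) (fun s _ => udu s) (uc _ _).
rewrite in_itv/= => /andP[ct c0] E.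
rewrite distrC E normrM sub0r normrN ler_wpM2r// duK//.
by rewrite !ler0_norm ?lerN2// ltW.
Qed.

Lemma norm_sin_le (t : R) : `|sin t| <= `|t|.
Proof.
have := @mean_value_le sin cos t 1 (@is_derive_sin R); rewrite sin0 subr0 mul1r; apply.
by move=> s _; rewrite ler_norml cos_geN1 cos_le1.
Qed.

Lemma norm_cos_sub1_le (t : R) : `|cos t - 1| <= t ^+ 2.
Proof.
have := @mean_value_le cos (fun s => - sin s) t `|t| (@is_derive_cos R).
rewrite cos0 -expr2 real_normK ?num_real//; apply=> s st.
by rewrite normrN (le_trans (norm_sin_le s)).
Qed.

Lemma norm_sin_sub_le (t : R) : `|sin t - t| <= t ^+ 2.
Proof.
have cl (s : R) : `|cos s - 1| <= `|s|.
  have := @mean_value_le cos (fun s => - sin s) s 1 (@is_derive_cos R).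
  rewrite cos0 mul1r; apply=> r _.
  by rewrite normrN ler_norml sin_geN1 sin_le1.
have := @mean_value_le (sin - id) (fun s => cos s - 1) t `|t|.
rewrite !fctE sin0 subrr subr0 -expr2 real_normK ?num_real//; apply=> // s st.
exact: le_trans (cl s) st.
Qed.

Lemma cmod_expi_sub1_le (t : R) : cmod (expi t - 1) <= 2 * `|t|.
Proof.
have H : `|cos t - 1| <= `|t|.
  have := @mean_value_le cos (fun s => - sin s) t 1 (@is_derive_cos R).
  rewrite cos0 mul1r; apply=> s _.
  by rewrite normrN ler_norml sin_geN1 sin_le1.
apply: le_trans (cmod_le _) _; rewrite mulr_natl mulr2n lerD//= oppr0 addr0.
exact: norm_sin_le.
Qed.

(** The factor 2 is the cost of bounding real and imaginary parts separately; it recurs in every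
    complex estimate below. *)
Lemma cmod_expi_taylor_le (t : R) : cmod (expi t - 1 - (0 +i* t)) <= 2 * t ^+ 2.
Proof.
apply: le_trans (cmod_le _) _; rewrite mulr_natl mulr2n lerD//=.
  by rewrite subr0 norm_cos_sub1_le.
by rewrite subr0 norm_sin_sub_le.
Qed.

End mean_value.

Section dot_product.
Local Open Scope complex_scope.
Context {R : realType} {m : nat}.
Implicit Types (x y z : 'rV[R]_m) (a : R).

Lemma dotC x y : dot x y = dot y x.
Proof. by apply: eq_bigr => i _; rewrite mulrC. Qed.

Lemma dotDl x y z : dot (x + y) z = dot x z + dot y z.
Proof. by rewrite /dot -big_split; apply: eq_bigr => i _ /=; rewrite mxE mulrDl. Qed.

Lemma dotDr x y z : dot z (x + y) = dot z x + dot z y.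
Proof. by rewrite !(dotC z) dotDl. Qed.

Lemma dotZl a x y : dot (a *: x) y = a * dot x y.
Proof. by rewrite /dot big_distrr; apply: eq_bigr => i _ /=; rewrite mxE mulrA. Qed.

Lemma dotZr a x y : dot x (a *: y) = a * dot x y.
Proof. by rewrite dotC dotZl dotC. Qed.

Lemma dotNl x y : dot (- x) y = - dot x y.
Proof. by rewrite -scaleN1r dotZl mulN1r. Qed.

Lemma dotNr x y : dot x (- y) = - dot x y.
Proof. by rewrite dotC dotNl dotC. Qed.

Lemma dotBl x y z : dot (x - y) z = dot x z - dot y z.
Proof. by rewrite dotDl dotNl. Qed.

Lemma dotBr x y z : dot z (x - y) = dot z x - dot z y.
Proof. by rewrite dotDr dotNr. Qed.

Lemma dot0l x : dot 0 x = 0.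
Proof. by rewrite -(scale0r 0) dotZl mul0r. Qed.

Lemma dot_ebasis x i : dot x (ebasis i) = x ord0 i.
Proof.
rewrite /dot (bigD1 i)//= mxE !eqxx mulr1 big1 ?addr0// => j ji.
by rewrite mxE (negbTE ji) andbF mulr0.
Qed.

Lemma norm_dot_le x y : `|dot x y| <= m%:R * `|x| * `|y|.
Proof.
apply: le_trans (ler_norm_sum _ _ _) _.
apply: (@le_trans _ _ (\sum_(i < m) `|x| * `|y|)).
  by apply: ler_sum => i _; rewrite normrM ler_pM ?ler_rV_norm.
by rewrite sumr_const card_ord -mulrA mulr_natl.
Qed.

Lemma measurable_dot d (T : measurableType d) (f g : T -> 'rV[R]_m) :
  (forall i, measurable_fun setT (fun t => f t ord0 i)) ->
  (forall i, measurable_fun setT (fun t => g t ord0 i)) ->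
  measurable_fun setT (fun t => dot (f t) (g t)).
Proof.
by move=> mf mg; apply: measurable_sum => i; exact: measurable_funM.
Qed.

End dot_product.

(** * Restriction to lines, and Lipschitz criteria *)

Section lines.
Local Open Scope complex_scope.
Context {R : realType} (m : nat).
Local Notation E := 'rV[R]_m.
Implicit Types (u : E -> R) (g : E -> R[i]) (x v : E).

Lemma is_derive_along u x v l (h : R) :
  is_derive (h *: v + x) v u l -> is_derive h 1 (fun t => u (t *: v + x)) l.
Proof.
move=> dl.
have E : (fun k : R => k^-1 *: (((fun t => u (t *: v + x)) \o shift h) (k *: 1) -
      u (h *: v + x))) =
    (fun k : R => k^-1 *: ((u \o shift (h *: v + x)) (k *: v) - u (h *: v + x))).
  by apply/funext => k /=; rewrite [k *: 1]mulr1 scalerDl addrA.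
split.
  by rewrite /derivable E; exact: ex_derive.
by rewrite /derive E; exact: derive_val.
Qed.

Lemma cis_derive_quadratic g x v d K :
  (forall h : R, cmod (g (h *: v + x) - g x - h%:C * d) <= K * h ^+ 2) ->
  cis_derive v g x d.
Proof.
move=> gK; split; apply: (@is_derive_quadratic _ _ _ _ _ _ K) => h.
  apply: le_trans (gK h); apply: le_trans (Re_le_cmod _).
  by rewrite !ReD !ReN Re_realM.
apply: le_trans (gK h); apply: le_trans (Im_le_cmod _).
by rewrite !ImD !ImN Im_realM.
Qed.

Lemma ccontinuous_lipschitz g K :
  (forall x y, cmod (g y - g x) <= K * `|y - x|) -> ccontinuous g.
Proof.
move=> gK.
suff H u : (forall x y, `|u y - u x| <= K * `|y - x|) ->
    forall x, {for x, continuous u}.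
  split; apply: H => x y; apply: le_trans (gK x y).
    by apply: le_trans (Re_le_cmod _); rewrite ReD; case: (g x).
  by apply: le_trans (Im_le_cmod _); rewrite ImD; case: (g x).
move=> uK x; apply/(@cvgrPdist_le _ _ _ (nbhs x) _) => e e0.
have K1 : 0 < `|K| + 1 by rewrite ltr_wpDl.
apply/(@nbhs_normP R E); exists (e / (`|K| + 1)); first by rewrite /= divr_gt0.
move=> y /= xy; rewrite distrC (le_trans (uK x y))// distrC.
apply: (@le_trans _ _ ((`|K| + 1) * `|x - y|)).
  by rewrite ler_wpM2r// (le_trans (ler_norm K))// lerDl.
by rewrite mulrC -ler_pdivlMr// ltW.
Qed.

End lines.

(** * Phases and Heisenberg operators on the Schwartz space *)

Section heisenberg.
Local Open Scope complex_scope.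
Context {R : realType} {m : nat}.
Local Notation E := 'rV[R]_m.
Implicit Types (p q x : E) (a : R) (g h : E -> R[i]).

Lemma slow_coord (i : 'I_m) : slow (fun x : E => (x ord0 i)%:C).
Proof.
apply: (@slow_family _ _ (fun phi => phi = (fun x : E => (x ord0 i)%:C) \/
  exists c, phi = fun=> c)); last by left.
- move=> _ [->|[c ->]]; last exact: ccontinuous_cst.
  apply: (@ccontinuous_lipschitz _ _ _ 1) => x y.
  rewrite (_ : _%:C - _ = ((y - x) ord0 i)%:C); last by rewrite !mxE rmorphB.
  by rewrite cmod_real mul1r ler_rV_norm.
- move=> _ [->|[c ->]] j; last first.
    exists (fun=> 0); split; first by right; exists 0.
    by move=> x; exact: cis_derive_cst.
  exists (fun=> (ebasis j ord0 i)%:C); split; first by right; eexists.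
  move=> x; apply: (@cis_derive_quadratic _ _ _ _ _ _ 0) => h.
  by rewrite !mxE rmorphD rmorphM addrK subrr cmod0 mul0r.
- move=> _ [->|[c ->]]; last first.
    by exists 0, (cmod c); split=> [|x]; rewrite ?cmod_ge0// expr0 mulr1.
  exists 1, 1; split=> // x; rewrite cmod_real mul1r expr1.
  by apply: le_trans (ler_rV_norm _ _) _; rewrite lerDr.
Qed.

Lemma cis_derive_phase a q i x :
  cis_derive (ebasis i) (fun x : E => expi (a + dot q x)) x
    ((0 +i* q ord0 i) * expi (a + dot q x)).
Proof.
apply: (@cis_derive_quadratic _ _ _ _ _ _ (2 * (q ord0 i) ^+ 2)) => h.
have -> : expi (a + dot q (h *: ebasis i + x)) = expi (a + dot q x) * expi (h * q ord0 i).
  by rewrite -expiD dotDr dotZr dot_ebasis; congr expi; ring.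
rewrite (_ : _ - _ = expi (a + dot q x) *
    (expi (h * q ord0 i) - 1 - (0 +i* (h * q ord0 i)))).
  rewrite cmodM cmod_expi mul1r; apply: le_trans (cmod_expi_taylor_le _) _.
  by rewrite le_eqVlt; apply/orP; left; apply/eqP; ring.
have -> : 0 +i* (h * q ord0 i) = h%:C * (0 +i* q ord0 i).
  by apply: eqC; rewrite ?ReM ?ImM/=; ring.
ring.
Qed.

(** Each derivative of a phase is a constant times the phase, so its constant multiples form a
    closed family of bounded functions. *)
Lemma slow_phase a q : slow (fun x : E => expi (a + dot q x)).
Proof.
apply: (@slow_family _ _ (fun phi => exists c, phi = fun x : E => c * expi (a + dot q x)));
  last by exists 1; apply/funext => x; rewrite mul1r.
- move=> _ [c ->]; apply: ccontinuousM; first exact: ccontinuous_cst.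
  apply: (@ccontinuous_lipschitz _ _ _ (2 * (m%:R * `|q|))) => x y.
  rewrite (_ : _ - _ = expi (a + dot q x) * (expi (dot q (y - x)) - 1)).
    rewrite cmodM cmod_expi mul1r (le_trans (cmod_expi_sub1_le _))// -mulrA.
    by rewrite ler_wpM2l// norm_dot_le.
  by rewrite mulrBr -expiD mulr1 dotBr; congr (expi _ - _); ring.
- move=> _ [c ->] i; exists (fun x => (c * (0 +i* q ord0 i)) * expi (a + dot q x)).
  split; first by eexists.
  move=> x; rewrite -[c * _]mulrC -mulrA.
  apply: (cis_derive_eq (d := 0 * expi (a + dot q x) + c * ((0 +i* q ord0 i) * expi (a + dot q x)))); last by ring.
  apply: cis_deriveM; first exact: cis_derive_cst.
  exact: cis_derive_phase.
- move=> _ [c ->]; exists 0, (cmod c); split=> [|x]; first exact: cmod_ge0.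
  by rewrite cmodM cmod_expi expr0.
Qed.

(** Translation by [p], then modulation of frequency [q], with a free phase [a]. The phase makes
    these operators closed under composition, so translations, modulations and their twisted
    combinations are all of this one form. *)
Definition heis p q a g : E -> R[i] := fun x => expi (a + dot q x) * g (x - p).

Lemma sop_heis p q a : sop (heis p q a).
Proof. exact: (sop_comp (sop_mul (slow_phase a q)) (sop_shift p)). Qed.

(** The Heisenberg group law: the term [- dot q' p] arises when the outer translation passes the
    inner modulation. *)
Lemma heis_comp p q a p' q' a' g :
  heis p q a (heis p' q' a' g) = heis (p + p') (q + q') (a + a' - dot q' p) g.
Proof.
apply/funext => x; rewrite /heis mulrA -expiD dotBr dotDl.
by congr (expi _ * g _); [ring | rewrite opprD addrA].
Qed.

Lemma heis_phase p q a b g x : expi b * heis p q a g x = heis p q (b + a) g x.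
Proof. by rewrite /heis mulrA -expiD addrA. Qed.

Lemma schwartz_heis p q a g : schwartz g -> schwartz (heis p q a g).
Proof. exact: (sop_heis p q a).1. Qed.

End heisenberg.

(** * Extension of operators to tempered distributions *)

Section tempered_distributions.
Local Open Scope complex_scope.
Context {R : realType} {m : nat}.
Local Notation E := 'rV[R]_m.
Implicit Types (g h : E -> R[i]) (f : @functional R m).

Definition clinear_on_schwartz (S : (E -> R[i]) -> E -> R[i]) :=
  forall (a : R[i]) g h, schwartz g -> schwartz h ->
    S (fun x => a * g x + h x) = (fun x => a * S g x + S h x).

Lemma schwartz_conj g : schwartz g -> schwartz (fun x => conjc (g x)).
Proof. exact: (@sop_conj R m).1. Qed.

Lemma tempered_scale f c g : tempered f -> schwartz g ->
  f (fun x => c * g x) = c * f g.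
Proof.
move=> [fl _] gS.
(* Linearity is stated for [a * g + h] only; taking both functions to be 0 gives f 0 = f 0 + f 0. *)
have f0 : f (fun=> 0) = 0.
  have := fl 1 _ _ (@schwartz0 R m) (@schwartz0 R m).
  rewrite (_ : (fun _ => _) = fun=> 0); last by apply/funext => x; rewrite mulr0 addr0.
  by rewrite mul1r => /eqP; rewrite -subr_eq0 opprD addrA subrr sub0r oppr_eq0 => /eqP.
have := fl c _ _ gS (@schwartz0 R m); rewrite f0 addr0 => <-.
by congr f; apply/funext => x; rewrite addr0.
Qed.

(** On test functions the extension is [f] composed with [S] conjugated on both sides; the two
    conjugations cancel on scalars, so linearity survives, and continuity of [S] gives the seminorm
    bound. *)
Lemma tempered_ext S f : sop S -> clinear_on_schwartz S ->
  tempered f -> tempered (ext_by_adjoint S f).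
Proof.
move=> Ss Sl [fl [N [C fC]]].
have Ts : sop (fun g x => conjc (S (fun y => conjc (g y)) x)).
  exact: (sop_comp (@sop_conj R m) (sop_comp Ss (@sop_conj R m))).
split=> [a g h gS hS|].
  rewrite /ext_by_adjoint /bracket.
  rewrite (_ : (fun x => conjc (S _ x)) = (fun x =>
    a * conjc (S (fun y => conjc (g y)) x) + conjc (S (fun y => conjc (h y)) x))).
    by rewrite fl//; exact: Ts.1.
  rewrite (_ : (fun x => conjc (a * g x + h x)) =
      (fun x => conjc a * conjc (g x) + conjc (h x))); last first.
    by apply/funext => x; rewrite rmorphD rmorphM.
  rewrite Sl; try exact: schwartz_conj.
  by apply/funext => x; rewrite [LHS]rmorphD [X in X + _]rmorphM [X in X * _]conjcK.
have [TS Tb] := Ts; have [N' [D [D0 TD]]] := Tb N.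
(* The constant of a tempered distribution carries no sign condition, hence the absolute value. *)
exists N', (`|C| * D) => g gS.
apply: le_trans (fC _ (TS _ gS)) _.
rewrite (schwartz_seminormE _ (TS _ gS)) (schwartz_seminormE _ gS) -!EFinM lee_fin.
rewrite -mulrA; apply: (@le_trans _ _ (`|C| * snorm N (fun x => conjc (S (fun y => conjc (g y)) x)))).
  by rewrite ler_wpM2r ?snorm_ge0// ler_norm.
by rewrite ler_wpM2l// TD.
Qed.

Lemma bracket_ext S f g : bracket (ext_by_adjoint S f) g = bracket f (S g).
Proof.
rewrite /bracket /ext_by_adjoint /bracket.
have -> : (fun x => conjc (conjc (g x))) = g by apply/funext => x; exact: conjcK.
by [].
Qed.

Lemma bracket_scale f c g : tempered f -> schwartz g ->
  bracket f (fun x => c * g x) = conjc c * bracket f g.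
Proof.
move=> ft gS; rewrite /bracket -tempered_scale//; last exact: schwartz_conj.
by congr f; apply/funext => x; rewrite rmorphM.
Qed.

End tempered_distributions.

(** * Complex integrals *)

Section complex_measurable.
Local Open Scope complex_scope.
Context {R : realType} d {T : measurableType d}.
Implicit Types (f g : T -> R[i]).

Definition cmeasurable f :=
  measurable_fun [set: T] (fun x => complex.Re (f x)) /\
  measurable_fun [set: T] (fun x => complex.Im (f x)).

Lemma cmeasurableM f g : cmeasurable f -> cmeasurable g ->
  cmeasurable (fun x => f x * g x).
Proof.
move=> [f1 f2] [g1 g2]; split.
  under eq_fun do rewrite ReM.
  by apply: measurable_funB; exact: measurable_funM.
under eq_fun do rewrite ImM.
by apply: measurable_funD; exact: measurable_funM.
Qed.

Lemma cmeasurable_expi (t : T -> R) : measurable_fun [set: T] t ->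
  cmeasurable (fun x => expi (t x)).
Proof.
move=> mt; split; apply: measurableT_comp mt; apply: continuous_measurable_fun.
  exact: continuous_cos.
exact: continuous_sin.
Qed.

Lemma cmeasurable_cmod f : cmeasurable f ->
  measurable_fun [set: T] (fun x => cmod (f x)).
Proof.
move=> [f1 f2].
rewrite (_ : (fun _ => _) = (fun x => Num.sqrt (complex.Re (f x) ^+ 2 + complex.Im (f x) ^+ 2))).
  apply: measurableT_comp; first exact: (continuous_measurable_fun (@sqrt_continuous R)).
  by apply: measurable_funD; exact: measurable_funX.
by apply/funext => x; case: (f x).
Qed.

End complex_measurable.

(** * Complex integrals: linearity, changes of variables, Fubini *)

Section complex_integral.
Local Open Scope complex_scope.
Context {R : realType} (m : nat).
Local Notation E := 'rV[R]_m.
Local Notation mu := (@lebesgue_rV R m).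
Implicit Types (f g : E -> R[i]) (u b : E -> R) (x p : E).

Definition rintegrable u := mu.-integrable [set: E] (EFin \o u).

Definition cintegrable f :=
  rintegrable (fun x => complex.Re (f x)) /\ rintegrable (fun x => complex.Im (f x)).

Lemma ccontinuous_measurable f : ccontinuous f -> cmeasurable f.
Proof. by move=> [f1 f2]; split; exact: continuous_measurable_rV. Qed.

Lemma rintegrable_le u b : measurable_fun [set: E] u ->
  (forall x, `|u x| <= b x) -> rintegrable b -> rintegrable u.
Proof.
move=> mf ub; apply: le_integrable => //; first exact/measurable_EFinP.
by move=> x _; rewrite /= lee_fin (le_trans (ub x))// ler_norm.
Qed.

Lemma rintegrableZ (k : R) u : rintegrable u -> rintegrable (fun x => k * u x).
Proof. exact: integrableZl. Qed.

Lemma rintegrableD u b : rintegrable u -> rintegrable b -> rintegrable (fun x => u x + b x).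
Proof. exact: integrableD. Qed.

Lemma cintegrable_le f b : cmeasurable f -> (forall x, cmod (f x) <= b x) ->
  rintegrable b -> cintegrable f.
Proof.
move=> [m1 m2] fb bi; split; apply: rintegrable_le bi => // x.
  exact: le_trans (Re_le_cmod _) _.
exact: le_trans (Im_le_cmod _) _.
Qed.

Lemma eq_cintegral f g : f =1 g -> cintegral f = cintegral g.
Proof. by move=> /funext ->. Qed.

Lemma cintegralD f g : cintegrable f -> cintegrable g ->
  cintegral (fun x => f x + g x) = cintegral f + cintegral g.
Proof.
move=> [f1 f2] [g1 g2]; apply: eqC; rewrite /cintegral /=.
  by rewrite -RintegralD//; apply: eq_Rintegral => x _; rewrite ReD.
by rewrite -RintegralD//; apply: eq_Rintegral => x _; rewrite ImD.
Qed.

Lemma cintegrableZ c f : cintegrable f -> cintegrable (fun x => c * f x).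
Proof.
move=> [f1 f2]; split.
  under eq_fun do rewrite ReM -mulNr.
  by apply: rintegrableD; exact: rintegrableZ.
under eq_fun do rewrite ImM.
by apply: rintegrableD; exact: rintegrableZ.
Qed.

Lemma cintegralZ c f : cintegrable f ->
  cintegral (fun x => c * f x) = c * cintegral f.
Proof.
move=> [f1 f2]; apply: eqC; rewrite ?ReM ?ImM /cintegral /=.
  rewrite -!RintegralZl// -RintegralB//; try exact: rintegrableZ.
  by apply: eq_Rintegral => x _; rewrite ReM.
rewrite -!RintegralZl// -RintegralD//; try exact: rintegrableZ.
by apply: eq_Rintegral => x _; rewrite ImM.
Qed.

Lemma cintegral_conj f : cintegrable f ->
  cintegral (fun x => conjc (f x)) = conjc (cintegral f).
Proof.
move=> [f1 f2]; apply: eqC; rewrite /cintegral /=.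
  by apply: eq_Rintegral => x _; case: (f x).
rewrite -mulN1r -RintegralZl//.
by apply: eq_Rintegral => x _; rewrite mulN1r; case: (f x).
Qed.

Lemma cintegral_le f b : cmeasurable f -> (forall x, cmod (f x) <= b x) ->
  rintegrable b -> cmod (cintegral f) <= 2 * Rintegral mu setT b.
Proof.
move=> mf fb bi; have [f1 f2] := cintegrable_le mf fb bi.
apply: le_trans (cmod_le _) _; rewrite /cintegral/= mulr_natl mulr2n lerD//.
  apply: le_trans (le_normr_Rintegral measurableT f1) _.
  apply: le_Rintegral => //; first by apply: (rintegrable_le _ _ bi) => [|x];
    [by apply: measurableT_comp => //; exact: mf.1|
     by rewrite normr_id (le_trans (Re_le_cmod _))].
  by move=> x _; rewrite (le_trans (Re_le_cmod _)).
apply: le_trans (le_normr_Rintegral measurableT f2) _.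
apply: le_Rintegral => //; first by apply: (rintegrable_le _ _ bi) => [|x];
  [by apply: measurableT_comp => //; exact: mf.2|
   by rewrite normr_id (le_trans (Im_le_cmod _))].
by move=> x _; rewrite (le_trans (Im_le_cmod _)).
Qed.

Lemma integrable_affine (a : R) p u : a != 0 -> rintegrable u ->
  rintegrable (fun x => u (a *: x + p)) /\
  Rintegral mu setT (fun x => u (a *: x + p)) = (`|a|^-1 ^+ m) * Rintegral mu setT u.
Proof.
move=> a0 ui; have := ui; move=> /integrableP[mu_ uoo].
have I (w : E -> \bar R) : measurable_fun [set: E] w -> (forall x, 0 <= w x)%E ->
    (\int[mu]_x w (a *: x + p)%R = (`|a|^-1 ^+ m)%:E * \int[mu]_x w x)%E.
  by move=> mw w0; exact: ge0_integral_affine.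
have ma : rintegrable (fun x => u (a *: x + p)).
  apply/integrableP; split.
    by apply: (measurableT_comp mu_); exact: measurable_rV_affine.
  rewrite (I (fun x => `|(EFin \o u) x|%E))//; last exact: measurableT_comp.
  by rewrite lte_mul_pinfty// lee_fin exprn_ge0.
split => //; rewrite /Rintegral.
have up := integrable_pos_fin_num measurableT ui.
have un := integrable_neg_fin_num measurableT ui.
rewrite integralE [in RHS]integralE.
have -> : (\int[mu]_x (fun x => (u (a *: x + p))%:E)^\+ x =
  \int[mu]_x (EFin \o u)^\+ (a *: x + p)%R)%E.
  by apply: eq_integral => x _; rewrite ?funeposE ?funenegE.
have -> : (\int[mu]_x (fun x => (u (a *: x + p))%:E)^\- x =
  \int[mu]_x (EFin \o u)^\- (a *: x + p)%R)%E.
  by apply: eq_integral => x _; rewrite ?funeposE ?funenegE.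
rewrite !I//; [|exact: measurable_funeneg|exact: measurable_funepos].
by rewrite -muleBr ?fineM ?fin_num_adde_defr// fin_numB up.
Qed.

Lemma cintegral_affine (a : R) p f : a != 0 -> cintegrable f ->
  cintegral (fun x => f (a *: x + p)) = (`|a|^-1 ^+ m)%:C * cintegral f.
Proof.
move=> a0 [f1 f2]; apply: eqC; rewrite ?ReM ?ImM /cintegral /= mul0r.
  by rewrite (integrable_affine p a0 f1).2 subr0.
by rewrite (integrable_affine p a0 f2).2 addr0.
Qed.

Lemma cintegral_shift p f : cintegrable f ->
  cintegral (fun x => f (x + p)) = cintegral f.
Proof.
move=> fi; have := cintegral_affine p (oner_neq0 R) fi.
rewrite normr1 invr1 expr1n mul1r => <-.
by apply: eq_cintegral => x; rewrite scale1r.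
Qed.

(** A bound by a product of two integrable functions gives integrability for the product measure,
    and is what a pair of Schwartz functions provides. *)
Lemma Rintegral_fubini (F : E -> E -> R) b c :
  measurable_fun [set: E * E] (fun z => F z.1 z.2) ->
  (forall x y, `|F x y| <= b x * c y) -> rintegrable b -> rintegrable c ->
  Rintegral mu setT (fun x => Rintegral mu setT (fun y => F x y)) =
  Rintegral mu setT (fun y => Rintegral mu setT (fun x => F x y)).
Proof.
move=> mF Fbc bi ci.
pose F' (z : E * E) : \bar R := (F z.1 z.2)%:E.
have mF' : measurable_fun [set: E * E] F' by apply/measurable_EFinP.
have m1 x : measurable_fun [set: E] (fun y => F x y).
  exact: (measurableT_comp mF (measurable_pair1 x)).
have m2 y : measurable_fun [set: E] (fun x => F x y).
  exact: (measurableT_comp mF (measurable_pair2 y)).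
have i1 x : rintegrable (fun y => F x y).
  by apply: (rintegrable_le _ (Fbc x)) => //; exact: rintegrableZ.
have i2 y : rintegrable (fun x => F x y).
  apply: (rintegrable_le (b := fun x => c y * b x)) => //; last exact: rintegrableZ.
  by move=> x; rewrite mulrC.
have iF : (mu \x mu)%E.-integrable [set: E * E] F'.
  apply/integrable12ltyP => //.
  pose C := Rintegral mu setT c.
  have CE : (\int[mu]_y (c y)%:E = C%:E)%E by rewrite fineK//; exact: integrable_fin_num.
  have IC x : (\int[mu]_y `|F' (x, y)| <= (C * b x)%:E)%E.
    rewrite mulrC EFinM -CE -integralZl//.
    apply: ge0_le_integral => //.
    - by apply/measurable_EFinP; apply: measurableT_comp => //; exact: m1.
    - by apply: measurable_funeM; case/integrableP: ci.
    - by move=> y _; rewrite /F'/= -EFinM lee_fin.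
  apply: (@le_lt_trans _ _ (\int[mu]_x (C * b x)%:E)%E); last first.
    exact: (integrable_lty measurableT (rintegrableZ C bi)).
  apply: ge0_le_integral => //.
  - by move=> x _; exact: integral_ge0.
  - apply: (measurable_fun_fubini_tonelli_F (fun z : E * E => `|F' z|%E)) => //.
    exact: measurableT_comp.
  - by case/integrableP: (rintegrableZ C bi).
have /= H := Fubini iF.
have E1 x : (Rintegral mu setT (fun y => F x y))%:E = (\int[mu]_y (F x y)%:E)%E.
  by rewrite fineK//; exact: (integrable_fin_num measurableT (i1 x)).
have E2 y : (Rintegral mu setT (fun x => F x y))%:E = (\int[mu]_x (F x y)%:E)%E.
  by rewrite fineK//; exact: (integrable_fin_num measurableT (i2 y)).
rewrite [LHS]/Rintegral [RHS]/Rintegral; congr fine.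
under eq_integral do rewrite E1.
by under [RHS]eq_integral do rewrite E2.
Qed.

Lemma cintegral_fubini (F : E -> E -> R[i]) b c :
  cmeasurable (fun z : E * E => F z.1 z.2) ->
  (forall x y, cmod (F x y) <= b x * c y) -> rintegrable b -> rintegrable c ->
  cintegral (fun x => cintegral (fun y => F x y)) =
  cintegral (fun y => cintegral (fun x => F x y)).
Proof.
move=> [m1 m2] Fbc bi ci; apply: eqC; rewrite /cintegral/=.
  apply: (Rintegral_fubini m1 _ bi ci) => x y.
  exact: le_trans (Re_le_cmod _) (Fbc x y).
apply: (Rintegral_fubini m2 _ bi ci) => x y.
exact: le_trans (Im_le_cmod _) (Fbc x y).
Qed.

End complex_integral.

(** * Fourier transform *)

Section fourier_transform.
Local Open Scope complex_scope.
Context {R : realType} (m : nat).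
Local Notation E := 'rV[R]_m.
Local Notation mu := (@lebesgue_rV R m).
Implicit Types (f g : E -> R[i]) (x y xi eta p q : E) (c s : R) (i : 'I_m).

Definition wint : R := Rintegral mu setT (@rV_weight R m).

Lemma wint_ge0 : 0 <= wint.
Proof. by apply: Rintegral_ge0 => x _; rewrite ltW// rV_weight_gt0. Qed.

Lemma rintegrable_weight : rintegrable (@rV_weight R m).
Proof. exact: integrable_rV_weight. Qed.

Lemma cintegrable_weight f K : cmeasurable f ->
  (forall x, cmod (f x) <= K * rV_weight x) -> cintegrable f.
Proof.
move=> mf fK; apply: (cintegrable_le mf fK).
exact: rintegrableZ rintegrable_weight.
Qed.

Lemma cintegral_weight_le f K : cmeasurable f ->
  (forall x, cmod (f x) <= K * rV_weight x) -> cmod (cintegral f) <= 2 * wint * K.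
Proof.
move=> mf fK; apply: le_trans (cintegral_le mf fK _) _.
  exact: rintegrableZ rintegrable_weight.
rewrite RintegralZl//; last exact: rintegrable_weight.
by rewrite [K * _]mulrC mulrA.
Qed.

(** Of the [m * 2 + j] powers of decay, [m * 2] form the integrable weight and [j] remain to absorb
    polynomial factors of the integrand. *)
Lemma schwartz_weight_le g (j : nat) x : schwartz g ->
  (1 + `|x|) ^+ j * cmod (g x) <= snorm (m * 2 + j) g * rV_weight x.
Proof.
move=> gS; rewrite /rV_weight ler_pdivlMr ?exprn_gt0 ?ltr_wpDr//.
have := @schwartz_bound _ _ (m * 2 + j) g [::] x gS (leq0n _).
by rewrite cpartials_nil exprD; apply: le_trans; rewrite le_eqVlt; apply/orP; left; apply/eqP; ring.
Qed.

Lemma schwartz_weight_le0 g x : schwartz g ->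
  cmod (g x) <= snorm (m * 2) g * rV_weight x.
Proof. by move=> /(@schwartz_weight_le _ 0 x); rewrite expr0 mul1r addn0. Qed.

Lemma schwartz_cmeasurable g : schwartz g -> cmeasurable g.
Proof. by move=> gS; exact/ccontinuous_measurable/schwartz_ccontinuous. Qed.

Lemma schwartz_cintegrable g : schwartz g -> cintegrable g.
Proof.
move=> gS; apply: (cintegrable_weight (schwartz_cmeasurable gS)) => x.
exact: schwartz_weight_le0.
Qed.

(** The point is that the second-order remainder is dominated by the integrable weight, uniformly
    for [|h| <= 1]. *)
Lemma schwartz_taylor g : schwartz g -> forall i, exists K, forall (h : R) x,
  `|h| <= 1 -> cmod (g (h *: ebasis i + x) - g x - h%:C * cderiv i g x) <=
    h ^+ 2 * (K * rV_weight x).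
Proof.
(* On the segment from [x] to [y] one has [1 + |x| <= 2 * (1 + |y|)], whence [2 ^+ (m * 2)] when the
   weight is moved from [y] to [x]. The outer 2 adds real and imaginary parts. *)
move=> gS i; exists (2 * (2 ^+ (m * 2) * snorm (m * 2 + 2) g)) => h x h1.
pose D2 t := cpartials [:: i; i] g (t *: ebasis i + x).
pose K := 2 ^+ (m * 2) * snorm (m * 2 + 2) g * rV_weight x.
have D2K t : `|t| <= 1 -> cmod (D2 t) <= K.
  move=> t1; rewrite /K /rV_weight ler_pdivlMr ?exprn_gt0 ?ltr_wpDr//.
  pose y := t *: ebasis i + x.
  have yb : (1 + `|y|) ^+ (m * 2) * cmod (D2 t) <= snorm (m * 2 + 2) g.
    apply: le_trans (@schwartz_bound _ _ (m * 2 + 2) g [:: i; i] y gS (leq_addl _ _)).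
    by rewrite ler_wpM2r ?cmod_ge0// le_weightX// leq_addr.
  rewrite mulrC; apply: (@le_trans _ _ (2 ^+ (m * 2) * ((1 + `|y|) ^+ (m * 2) * cmod (D2 t)))).
    rewrite mulrA -exprMn ler_wpM2r ?cmod_ge0// lerXn2r ?nnegrE ?mulr_ge0 ?addr_ge0//.
    have e1 : `|t *: ebasis i| <= 1.
      rewrite normrZ -[1]mulr1 ler_pM//.
      apply: rV_norm_le => // j; rewrite mxE eqxx/=.
      by case: (j == i); rewrite ?normr1 ?normr0.
    have := ler_normB y (t *: ebasis i); rewrite {1}/y addrAC subrr add0r.
    by have := normr_ge0 y; lra.
  by rewrite ler_wpM2l// exprn_ge0.
(* Second-order Taylor bound on the line from two uses of the mean value inequality, first for [u1]
   and then for [u] minus its tangent at 0. *)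
have T (u u1 u2 : R -> R) : (forall t : R, is_derive t 1 u (u1 t)) ->
    (forall t : R, is_derive t 1 u1 (u2 t)) -> (forall t, `|t| <= 1 -> `|u2 t| <= K) ->
    `|u h - u 0 - h * u1 0| <= K * h ^+ 2.
  move=> d1 d2 u2K.
  have H t : `|t| <= `|h| -> `|u1 t - u1 0| <= K * `|h|.
    move=> th; apply: (@le_trans _ _ (K * `|t|)).
      apply: mean_value_le d2 _ => r rt; apply: u2K.
      exact: le_trans rt (le_trans th h1).
    apply: ler_wpM2l th; apply: le_trans (u2K 0 _); rewrite ?normr_ge0//.
    by rewrite normr0.
  have := @mean_value_le _ (fun t => u t - u1 0 * t) (fun t => u1 t - u1 0) h (K * `|h|).
  rewrite mulr0 subr0 -mulrA -expr2 real_normK ?num_real//.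
  move=> HH; rewrite [h * _]mulrC addrAC; apply: HH => [t|t th]; last exact: H.
  rewrite (_ : (fun t => _) = u - (u1 0 *: id)); last by [].
  by apply: is_derive_eq; rewrite [_ *: _]mulr1.
have gd t : cis_derive (ebasis i) g (t *: ebasis i + x) (cderiv i g (t *: ebasis i + x)).
  exact: schwartz_cis_derive0.
have gdd t : cis_derive (ebasis i) (cderiv i g) (t *: ebasis i + x) (D2 t).
  have := schwartz_cis_derive gS [:: i] i (t *: ebasis i + x).
  by rewrite -[[:: i]]/(rcons [::] i) cpartials_rcons cpartials_nil.
have T1 := @T (fun t => complex.Re (g (t *: ebasis i + x)))
  (fun t => complex.Re (cderiv i g (t *: ebasis i + x))) (fun t => complex.Re (D2 t)).
have T2 := @T (fun t => complex.Im (g (t *: ebasis i + x)))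
  (fun t => complex.Im (cderiv i g (t *: ebasis i + x))) (fun t => complex.Im (D2 t)).
apply: le_trans (cmod_le _) _.
rewrite !ReD !ImD !ReN !ImN Re_realM Im_realM.
have -> : h ^+ 2 * (2 * (2 ^+ (m * 2) * snorm (m * 2 + 2) g) * rV_weight x) =
    K * h ^+ 2 + K * h ^+ 2 by rewrite /K; ring.
rewrite scale0r add0r in T1 T2.
apply: lerD.
  apply: T1 => [t|t|t t1]; first exact: is_derive_along (gd t).1.
    exact: is_derive_along (gdd t).1.
  exact: le_trans (Re_le_cmod _) (D2K t t1).
apply: T2 => [t|t|t t1]; first exact: is_derive_along (gd t).2.
  exact: is_derive_along (gdd t).2.
exact: le_trans (Im_le_cmod _) (D2K t t1).
Qed.

(* By translation invariance the integral of a difference quotient vanishes. *)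
Lemma cintegral_cderiv g i : schwartz g -> cintegral (cderiv i g) = 0.
Proof.
move=> gS; have [K gK] := schwartz_taylor gS i.
have dS := (sop_cderiv i).1 _ gS.
apply/eqP; rewrite -cmod_eq0 eq_le cmod_ge0 andbT leNgt; apply/negP => d0.
set d := cmod _ in d0.
have H h : 0 < h <= 1 -> d <= h * (2 * wint * K).
  move=> /andP[h0 h1].
  have shS : schwartz (fun x => g (x - (- (h *: ebasis i)))) by exact: (sop_shift _).1.
  pose F x := g (h *: ebasis i + x) - g x - h%:C * cderiv i g x.
  have FE x : F x = (-1) * g x + g (x - (- (h *: ebasis i))) + (- h%:C) * cderiv i g x.
    by rewrite /F opprK [x + _]addrC; ring.
  have F1S : schwartz (fun x => (-1) * g x + g (x - (- (h *: ebasis i)))).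
    exact: schwartz_lin.
  have FS : schwartz F.
    rewrite (_ : F = (fun x => (- h%:C) * cderiv i g x +
      ((-1) * g x + g (x - (- (h *: ebasis i)))))).
      exact: schwartz_lin.
    by apply/funext => x; rewrite FE addrC.
  have FI : cintegral F = - h%:C * cintegral (cderiv i g).
    rewrite (eq_cintegral FE) cintegralD; last 2 first.
    - exact: schwartz_cintegrable.
    - exact/cintegrableZ/schwartz_cintegrable.
    rewrite cintegralD; last 2 first.
    - exact/cintegrableZ/schwartz_cintegrable.
    - exact: schwartz_cintegrable.
    rewrite !cintegralZ; try exact: schwartz_cintegrable.
    by rewrite cintegral_shift ?mulN1r ?addNr ?add0r//; exact: schwartz_cintegrable.
  have := @cintegral_weight_le F (h ^+ 2 * K) (schwartz_cmeasurable FS).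
  rewrite FI cmodM cmodN cmod_real gtr0_norm// -/d => HH.
  rewrite -(ler_pM2l h0); apply: le_trans (HH _) _.
    by move=> x; rewrite -mulrA; apply: gK; rewrite gtr0_norm.
  by rewrite le_eqVlt; apply/orP; left; apply/eqP; ring.
set M := 2 * wint * K in H.
have M0 : 0 < M by have := H 1; rewrite ltr01 lexx mul1r => /(_ isT); lra.
(* Small enough that [e * M <= d / 2], against [d <= e * M] with [d] positive. *)
pose e := Num.min 1 (d / (2 * M)).
have e0 : 0 < e by rewrite lt_min ltr01 divr_gt0// mulr_gt0.
have e1 : e <= 1 by rewrite ge_min lexx.
have : e * M <= d / 2.
  apply: (@le_trans _ _ (d / (2 * M) * M)).
    by rewrite ler_wpM2r ?(ltW M0)// ge_min lexx orbT.
  by rewrite le_eqVlt; apply/orP; left; apply/eqP; field; rewrite gt_eqF.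
by have := H e; rewrite e0 e1 => /(_ isT); lra.
Qed.

(** Unnormalised, with the dilation built into the kernel: [c = clam lam] gives the twisted
    transform, [- clam lam] its adjoint, and 1 and -1 the classical transform and its inverse, each
    up to a scalar. *)
Definition ft c g : E -> R[i] := fun xi =>
  cintegral (fun eta => g eta * expi (- dot (c *: xi) eta)).

Lemma schwartz_phase g a q : schwartz g -> schwartz (fun x => g x * expi (a + dot q x)).
Proof.
move=> gS; have := (sop_mul (slow_phase a q)).1 _ gS.
by rewrite (_ : (fun x => _ * g x) = (fun x => g x * expi (a + dot q x)))//;
  apply/funext => x; rewrite mulrC.
Qed.

Lemma schwartz_ft_kernel c g xi : schwartz g ->
  schwartz (fun eta => g eta * expi (- dot (c *: xi) eta)).
Proof.
move=> /(schwartz_phase 0 (- (c *: xi))).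
by under eq_fun do rewrite add0r dotNl.
Qed.

Lemma ft_clinear c : clinear_on_schwartz (ft c).
Proof.
move=> a g h gS hS; apply/funext => xi; rewrite /ft.
rewrite -cintegralZ; last exact/schwartz_cintegrable/schwartz_ft_kernel.
rewrite -cintegralD; last 2 first.
- exact/cintegrableZ/schwartz_cintegrable/schwartz_ft_kernel.
- exact/schwartz_cintegrable/schwartz_ft_kernel.
by apply: eq_cintegral => x; rewrite mulrDl mulrA.
Qed.

Lemma ft_bound c g xi : schwartz g -> cmod (ft c g xi) <= 2 * wint * snorm (m * 2) g.
Proof.
move=> gS; apply: cintegral_weight_le.
  exact/schwartz_cmeasurable/schwartz_ft_kernel.
by move=> x; rewrite cmodM cmod_expi mulr1 schwartz_weight_le0.
Qed.

(** The two kernels differ by at most a multiple of [|xi' - xi| * |x|], which costs one more power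
    of decay. *)
Lemma ftB_le c g xi xi' : schwartz g ->
  cmod (ft c g xi' - ft c g xi) <=
  2 * wint * (2 * (`|c| * m%:R) * snorm (m * 2 + 1) g) * `|xi' - xi|.
Proof.
move=> gS.
have -> : ft c g xi' - ft c g xi = cintegral (fun eta =>
    (-1) * (g eta * expi (- dot (c *: xi) eta)) + g eta * expi (- dot (c *: xi') eta)).
  rewrite cintegralD; last 2 first.
  - exact/cintegrableZ/schwartz_cintegrable/schwartz_ft_kernel.
  - exact/schwartz_cintegrable/schwartz_ft_kernel.
  rewrite cintegralZ; last exact/schwartz_cintegrable/schwartz_ft_kernel.
  by rewrite mulN1r addrC.
rewrite -mulrA; apply: cintegral_weight_le.
  by apply: schwartz_cmeasurable; apply: schwartz_lin; exact: schwartz_ft_kernel.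
move=> x.
have -> : -1 * (g x * expi (- dot (c *: xi) x)) + g x * expi (- dot (c *: xi') x) =
    expi (- dot (c *: xi) x) * (expi (- (c * dot (xi' - xi) x)) - 1) * g x.
  have -> : expi (- dot (c *: xi') x) =
      expi (- dot (c *: xi) x) * expi (- (c * dot (xi' - xi) x)).
    by rewrite -expiD !dotZl dotBl; congr expi; ring.
  by ring.
rewrite !cmodM cmod_expi mul1r.
apply: (@le_trans _ _ (2 * `|- (c * dot (xi' - xi) x)| * cmod (g x))).
  by rewrite ler_wpM2r ?cmod_ge0// cmod_expi_sub1_le.
rewrite normrN normrM.
apply: (@le_trans _ _ (2 * (`|c| * (m%:R * `|xi' - xi| * (1 + `|x|))) * cmod (g x))).
  rewrite ler_wpM2r ?cmod_ge0// ler_wpM2l// ler_wpM2l//.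
  apply: le_trans (norm_dot_le _ _) _.
  by rewrite ler_wpM2l ?mulr_ge0// lerDr.
have := @schwartz_weight_le g 1 x gS; rewrite expr1 => gw.
have A0 : 0 <= 2 * (`|c| * m%:R) * `|xi' - xi| by rewrite !mulr_ge0.
have := ler_wpM2l A0 gw; congr (_ <= _); ring.
Qed.

Lemma ccontinuous_ft c g : schwartz g -> ccontinuous (ft c g).
Proof. by move=> gS; apply: ccontinuous_lipschitz => x y; exact: ftB_le. Qed.

(** The factor brought down by differentiating the Fourier kernel in the [i]-th frequency. *)
Definition mul_coord c i g : E -> R[i] := fun x => (0 +i* (- (c * x ord0 i))) * g x.

Lemma sop_mul_coord c i : sop (mul_coord c i).
Proof.
have := sop_comp (sop_scale m (0 +i* (- c))) (sop_mul (@slow_coord R m i)).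
rewrite (_ : (fun g x => _) = mul_coord c i)//.
apply/funext => g; apply/funext => x; rewrite /mul_coord mulrA; congr (_ * _).
by apply: eqC; rewrite ?ReM ?ImM/=; ring.
Qed.

(** Differentiation under the integral: the remainder is a single integral [G], whose kernel is
    controlled by the Taylor bound of the phase, hence by [h ^+ 2] times two extra powers of
    [1 + |x|]. *)
Lemma cis_derive_ft c g i xi : schwartz g ->
  cis_derive (ebasis i) (ft c g) xi (ft c (mul_coord c i g) xi).
Proof.
move=> gS; have xgS := (sop_mul_coord c i).1 _ gS.
apply: (@cis_derive_quadratic _ _ _ _ _ _ (2 * wint * (2 * c ^+ 2 * snorm (m * 2 + 2) g))) => h.
pose F eta := (-1) * (g eta * expi (- dot (c *: xi) eta)) +
  g eta * expi (- dot (c *: (h *: ebasis i + xi)) eta).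
pose G eta := (- h%:C) * (mul_coord c i g eta * expi (- dot (c *: xi) eta)) + F eta.
have FS : schwartz F by apply: schwartz_lin; exact: schwartz_ft_kernel.
have GS : schwartz G by apply: schwartz_lin => //; exact: schwartz_ft_kernel.
have -> : ft c g (h *: ebasis i + xi) - ft c g xi - h%:C * ft c (mul_coord c i g) xi =
    cintegral G.
  rewrite /G cintegralD; last 2 first.
  - exact/cintegrableZ/schwartz_cintegrable/schwartz_ft_kernel.
  - exact: schwartz_cintegrable.
  rewrite /F cintegralD; last 2 first.
  - exact/cintegrableZ/schwartz_cintegrable/schwartz_ft_kernel.
  - exact/schwartz_cintegrable/schwartz_ft_kernel.
  rewrite !cintegralZ; try exact/schwartz_cintegrable/schwartz_ft_kernel.
  by rewrite -/(ft c g xi) /ft; ring.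
rewrite -mulrA; apply: cintegral_weight_le; first exact: schwartz_cmeasurable.
move=> x; pose t := - (c * (h * x ord0 i)).
have -> : G x = expi (- dot (c *: xi) x) * (expi t - 1 - (0 +i* t)) * g x.
  rewrite /G /F /mul_coord.
  have -> : expi (- dot (c *: (h *: ebasis i + xi)) x) = expi (- dot (c *: xi) x) * expi t.
    rewrite -expiD !dotZl dotDl dotZl [dot (ebasis i) x]dotC dot_ebasis.
    by congr expi; rewrite /t; ring.
  have -> : 0 +i* t = h%:C * (0 +i* (- (c * x ord0 i))).
    by apply: eqC; rewrite ?ReM ?ImM/= /t; ring.
  have alg (a b d e w : R[i]) :
    - a * (b * d * e) + (-1 * (d * e) + d * (e * w)) = e * (w - 1 - a * b) * d by ring.
  exact: alg.
rewrite !cmodM cmod_expi mul1r.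
apply: (@le_trans _ _ (2 * t ^+ 2 * cmod (g x))).
  by rewrite ler_wpM2r ?cmod_ge0// cmod_expi_taylor_le.
have tb : t ^+ 2 <= (c * h) ^+ 2 * (1 + `|x|) ^+ 2.
  rewrite /t sqrrN mulrA exprMn ler_wpM2l ?sqr_ge0//.
  rewrite -(real_normK (num_real (x ord0 i))) lerXn2r ?nnegrE ?addr_ge0//.
  by apply: le_trans (ler_rV_norm _ _) _; rewrite lerDr.
apply: (@le_trans _ _ (2 * ((c * h) ^+ 2 * (1 + `|x|) ^+ 2) * cmod (g x))).
  by rewrite ler_wpM2r ?cmod_ge0// ler_wpM2l.
have A0 : 0 <= 2 * (c * h) ^+ 2 by rewrite mulr_ge0// sqr_ge0.
have := ler_wpM2l A0 (@schwartz_weight_le g 2 x gS); congr (_ <= _); ring.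
Qed.

(** Integration by parts, in the form that the integral of the derivative of [g] times the kernel
    vanishes. *)
Lemma ft_cderiv c g i xi : schwartz g ->
  ft c (cderiv i g) xi = (0 +i* (c * xi ord0 i)) * ft c g xi.
Proof.
move=> gS; have kS := schwartz_ft_kernel c xi gS.
have dS := (sop_cderiv i).1 _ gS.
pose e x := expi (0 + dot (- (c *: xi)) x) : R[i].
have ke : (fun eta => g eta * expi (- dot (c *: xi) eta)) = (fun eta => g eta * e eta).
  by apply/funext => x; rewrite /e add0r dotNl.
have kd x : cderiv i (fun eta => g eta * expi (- dot (c *: xi) eta)) x =
    cderiv i g x * expi (- dot (c *: xi) x) +
    (0 +i* (- (c * xi ord0 i))) * (g x * expi (- dot (c *: xi) x)).
  apply: cis_derive_cderiv.
  have ed : cis_derive (ebasis i) (fun eta => expi (- dot (c *: xi) eta)) x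
      ((0 +i* (- (c * xi ord0 i))) * expi (- dot (c *: xi) x)).
    have := cis_derive_phase 0 (- (c *: xi)) i x.
    by under eq_fun do rewrite add0r dotNl; rewrite add0r dotNl !mxE.
  apply: cis_derive_eq; first apply: cis_deriveM ed.
    exact: schwartz_cis_derive0.
  by rewrite mulrCA.
have := cintegral_cderiv i kS.
rewrite (eq_cintegral kd) cintegralD; last 2 first.
- exact/schwartz_cintegrable/schwartz_ft_kernel.
- exact/cintegrableZ/schwartz_cintegrable.
rewrite cintegralZ; last exact: schwartz_cintegrable.
rewrite -/(ft c (cderiv i g) xi) -/(ft c g xi) => /eqP.
rewrite addr_eq0 => /eqP ->; rewrite -mulNr; congr (_ * _).
by apply: eqC; rewrite ?ReN ?ImN/= ?oppr0 ?opprK.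
Qed.

End fourier_transform.

(** * Decay of the transform, multiplication formula, inversion *)

Section fourier_inversion.
Local Open Scope complex_scope.
Context {R : realType} (m : nat).
Local Notation E := 'rV[R]_m.
Local Notation mu := (@lebesgue_rV R m).
Implicit Types (f g k : E -> R[i]) (x y xi eta p q : E) (c s : R) (i : 'I_m).

Lemma rV_norm_le_sum x : `|x| <= \sum_(i < m) `|x ord0 i|.
Proof.
apply: rV_norm_le => [|i]; first exact: sumr_ge0.
by rewrite (bigD1 i)//= lerDl sumr_ge0.
Qed.

(** Induction on the power of the weight: one factor [1 + |xi|] is at most 1 plus the sum of the
    [|xi_i|], and each [|xi_i|] is traded for [|c|^-1] and one derivative of [g]. *)
Lemma ft_pointwise_bounded c : c != 0 -> pointwise_bounded (@ft R m c).
Proof.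
move=> c0; elim=> [|N [N' [C [C0 ih]]]].
  exists (m * 2)%N, (2 * wint m); split=> [|g gS x].
    by rewrite mulr_ge0// wint_ge0.
  by rewrite expr0 mul1r ft_bound.
exists N'.+1, (C * (1 + m%:R * `|c|^-1)); split=> [|g gS xi].
  by rewrite mulr_ge0// addr_ge0// mulr_ge0// invr_ge0.
have dle i : (1 + `|xi|) ^+ N * (`|xi ord0 i| * cmod (ft c g xi)) <=
    `|c|^-1 * (C * snorm N'.+1 g).
  have dS := (sop_cderiv i).1 _ gS.
  have -> : `|xi ord0 i| * cmod (ft c g xi) = `|c|^-1 * cmod (ft c (cderiv i g) xi).
    rewrite ft_cderiv// cmodM (_ : cmod (0 +i* _) = `|c| * `|xi ord0 i|).
      by rewrite !mulrA mulVf ?normr_eq0// mul1r.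
    by rewrite -normrM -cmod_real /cmod/= expr0n/= addr0 add0r.
  rewrite mulrCA ler_wpM2l ?invr_ge0//.
  apply: le_trans (ih _ dS xi) _; rewrite ler_wpM2l//.
  apply: snorm_le => s x sN.
  rewrite -cpartials_rcons; apply: le_trans (@schwartz_bound _ _ N'.+1 g (rcons s i) x gS _).
    by rewrite ler_wpM2r ?cmod_ge0// le_weightX.
  by rewrite size_rcons.
rewrite exprSr -mulrA mulrDl mul1r mulrDr mulrDr mulr1 mulrDl lerD//.
  apply: le_trans (ih _ gS xi) _; rewrite ler_wpM2l//.
  exact: snorm_mono.
apply: (@le_trans _ _ (\sum_(i < m) (1 + `|xi|) ^+ N * (`|xi ord0 i| * cmod (ft c g xi)))).
  rewrite -mulr_sumr -mulr_suml ler_wpM2l ?weightX_ge0// ler_wpM2r ?cmod_ge0//.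
  exact: rV_norm_le_sum.
apply: le_trans; first by apply: ler_sum => i _; exact: dle.
rewrite sumr_const card_ord -mulr_natl le_eqVlt; apply/orP; left; apply/eqP; ring.
Qed.

(** The family is [ft c] precomposed with continuous operators; differentiating merely adds a
    [mul_coord] to the inner operator. *)
Lemma sop_ft c : c != 0 -> sop (@ft R m c).
Proof.
move=> c0.
apply: (@sop_family _ _ (fun T => exists A, sop A /\ T = fun g => ft c (A g))); last first.
  by exists id; split => //; exact: sop_id.
- move=> _ [A [As ->]] N.
  have [N1 [C1 [C10 ftC]]] := ft_pointwise_bounded c0 N.
  have [AS Ab] := As; have [N2 [C2 [C20 AC]]] := Ab N1.
  exists N2, (C1 * C2); split=> [|g gS x]; first exact: mulr_ge0.
  apply: le_trans (ftC _ (AS _ gS) x) _.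
  by rewrite -mulrA ler_wpM2l// AC.
- move=> _ [A [As ->]] i; exists (fun g => ft c (mul_coord c i (A g))); split.
    exists (fun g => mul_coord c i (A g)); split => //.
    exact: sop_comp (sop_mul_coord c i) As.
  move=> g gS x; apply: cis_derive_ft; exact: As.1.
- move=> _ [A [As ->]] g gS; apply: ccontinuous_ft; exact: As.1.
Qed.

(** Translation and modulation trade places; the phase [dot q p] comes from the change of variables
    by [p]. *)
Lemma ft_heis c p q a g : c != 0 -> schwartz g ->
  ft c (heis p q a g) = heis (c^-1 *: q) (- c *: p) (a + dot q p) (ft c g).
Proof.
move=> c0 gS; apply/funext => xi; rewrite /ft.
have kS := schwartz_ft_kernel c xi (schwartz_heis p q a gS).
rewrite -(cintegral_shift p (schwartz_cintegrable kS)) /heis.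
rewrite -cintegralZ; last exact/schwartz_cintegrable/schwartz_ft_kernel.
apply: eq_cintegral => x; rewrite addrK.
rewrite -mulrA !(mulrC (g x)) !mulrA -!expiD; congr (expi _ * _).
by rewrite scalerBr scalerA divff// scale1r !dotDr !dotBl !dotZl [dot xi p]dotC; ring.
Qed.

Lemma ft_scale c g xi : ft c g xi = ft 1 g (c *: xi).
Proof. by rewrite /ft scale1r. Qed.

Lemma ft_mul_formula c g k : c != 0 -> schwartz g -> schwartz k ->
  cintegral (fun xi => ft c g xi * k xi) = cintegral (fun eta => g eta * ft c k eta).
Proof.
move=> c0 gS kS.
pose F xi eta := k xi * (g eta * expi (- dot (c *: xi) eta)).
have -> : cintegral (fun xi => ft c g xi * k xi) =
    cintegral (fun xi => cintegral (fun eta => F xi eta)).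
  apply: eq_cintegral => xi; rewrite /F cintegralZ; first exact: mulrC.
  exact/schwartz_cintegrable/schwartz_ft_kernel.
have -> : cintegral (fun eta => g eta * ft c k eta) =
    cintegral (fun eta => cintegral (fun xi => F xi eta)).
  apply: eq_cintegral => eta; rewrite /ft -cintegralZ; last first.
    exact/schwartz_cintegrable/schwartz_ft_kernel.
  apply: eq_cintegral => xi; rewrite /F mulrCA; congr (_ * (_ * _)).
  by rewrite !dotZl dotC.
apply: (@cintegral_fubini _ _ _ (fun x => snorm (m * 2) k * rV_weight x)
  (fun x => snorm (m * 2) g * rV_weight x)).
- have cm1 (u : E -> R[i]) : cmeasurable u -> cmeasurable (fun z : E * E => u z.1).
    by move=> [u1 u2]; split; [exact: (measurableT_comp u1)|exact: (measurableT_comp u2)].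
  have cm2 (u : E -> R[i]) : cmeasurable u -> cmeasurable (fun z : E * E => u z.2).
    by move=> [u1 u2]; split; [exact: (measurableT_comp u1)|exact: (measurableT_comp u2)].
  apply: cmeasurableM; first exact/cm1/schwartz_cmeasurable.
  apply: cmeasurableM; first exact/cm2/schwartz_cmeasurable.
  apply: cmeasurable_expi; apply: measurableT_comp => //.
  apply: measurable_dot => i.
    under eq_fun do rewrite mxE; apply: measurable_funM => //.
    exact: (measurableT_comp (measurable_coord i)).
  exact: (measurableT_comp (measurable_coord i)).
- move=> x y; rewrite /F !cmodM cmod_expi mulr1 ler_pM ?cmod_ge0//.
    exact: schwartz_weight_le0.
  exact: schwartz_weight_le0.
- exact: rintegrableZ (rintegrable_weight m).
- exact: rintegrableZ (rintegrable_weight m).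
Qed.

(** The path from 0 to [x] runs along the coordinate axes: [m] steps, each controlled by one partial
    derivative. *)
Lemma schwartz_lipschitz g : schwartz g -> exists L, 0 <= L /\
  forall x, cmod (g x - g 0) <= L * `|x|.
Proof.
move=> gS; pose L := snorm 1 g.
have L0 : 0 <= L by exact: snorm_ge0.
have step i y (t : R) : cmod (g (t *: ebasis i + y) - g y) <= 2 * L * `|t|.
  have dL z : cmod (cderiv i g z) <= L.
    have := @schwartz_bound _ _ 1 g [:: i] z gS (leqnn _).
    rewrite -[[:: i]]/(rcons [::] i) cpartials_rcons cpartials_nil; apply: le_trans.
    by rewrite ler_peMl ?cmod_ge0// expr1 weight_ge1.
  have gd (r : R) : cis_derive (ebasis i) g (r *: ebasis i + y) (cderiv i g (r *: ebasis i + y)).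
    exact: schwartz_cis_derive0.
  apply: le_trans (cmod_le _) _; rewrite -mulrA mulr_natl mulr2n ReD ImD ReN ImN.
  have M1 := @mean_value_le _ (fun r => complex.Re (g (r *: ebasis i + y)))
    (fun r => complex.Re (cderiv i g (r *: ebasis i + y))) t L
    (fun r => is_derive_along (gd r).1).
  have M2 := @mean_value_le _ (fun r => complex.Im (g (r *: ebasis i + y)))
    (fun r => complex.Im (cderiv i g (r *: ebasis i + y))) t L
    (fun r => is_derive_along (gd r).2).
  rewrite scale0r add0r in M1 M2.
  apply: lerD; [apply: M1|apply: M2] => r _.
    exact: le_trans (Re_le_cmod _) (dL _).
  exact: le_trans (Im_le_cmod _) (dL _).
exists (m%:R * (2 * L)); split=> [|x]; first by rewrite !mulr_ge0.
have H (l : seq 'I_m) : cmod (g (\sum_(i <- l) x ord0 i *: ebasis i) - g 0) <=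
    (size l)%:R * (2 * L) * `|x|.
  elim: l => [|i l ih]; first by rewrite big_nil subrr cmod0 !mul0r.
  rewrite big_cons /= -natr1 mulrDl mulrDl mul1r.
  set y := \sum_(j <- l) _ in ih *.
  rewrite -[g _ - g 0](subrKA (g y)) addrC.
  apply: le_trans (cmodD _ _) _; apply: lerD => //.
  apply: le_trans (step _ _ _) _.
  by rewrite ler_wpM2l ?mulr_ge0// ler_rV_norm.
have := H (index_enum 'I_m).
rewrite -row_sum_delta.
by rewrite (_ : size _ = m)//; rewrite -[RHS](card_ord m) cardT enumT.
Qed.

Lemma cintegral_dilation c f g : c != 0 -> schwartz f -> schwartz g ->
  cintegrable (fun x => f x * g (c *: x)).
Proof.
move=> c0 fS gS.
apply: (@cintegrable_weight _ _ _ (snorm 0 g * snorm (m * 2) f)).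
  apply: cmeasurableM; first exact: schwartz_cmeasurable.
  have [g1 g2] := schwartz_cmeasurable gS.
  have ma : measurable_fun [set: E] (fun x : E => c *: x).
    by have := measurable_rV_affine c (0 : E); under eq_fun do rewrite addr0.
  by split; [exact: (measurableT_comp g1)|exact: (measurableT_comp g2)].
move=> x; rewrite cmodM mulrC -mulrA ler_pM ?cmod_ge0//.
  have := @schwartz_bound _ _ 0 g [::] (c *: x) gS (leqnn _).
  by rewrite cpartials_nil expr0 mul1r.
exact: schwartz_weight_le0.
Qed.

(** As [c] tends to 0, [g (c *: x)] tends to [g 0] at a linear rate in [c], with a factor [1 + |x|]
    that the decay of [f] absorbs. *)
Lemma cintegral_dilation_limit f g : schwartz f -> schwartz g ->
  exists K, forall c, 0 < c ->
    cmod (cintegral (fun x => f x * g (c *: x)) - g 0 * cintegral f) <= K * c.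
Proof.
move=> fS gS; have [L [L0 gL]] := schwartz_lipschitz gS.
exists (2 * wint m * (L * snorm (m * 2 + 1) f)) => c c0.
have c0' : c != 0 by rewrite gt_eqF.
have fgi := cintegral_dilation c0' fS gS.
have fi := schwartz_cintegrable fS.
have -> : cintegral (fun x => f x * g (c *: x)) - g 0 * cintegral f =
    cintegral (fun x => f x * g (c *: x) + (- g 0) * f x).
  rewrite cintegralD//; last exact: cintegrableZ.
  by rewrite cintegralZ// mulNr.
rewrite -mulrA; apply: cintegral_weight_le.
  have [[/measurable_int m1 /measurable_int m2] [/measurable_int m3 /measurable_int m4]] :=
    (fgi, cintegrableZ (- g 0) fi).
  split.
    under eq_fun do rewrite ReD.
    by apply: measurable_funD; exact/measurable_EFinP.
  under eq_fun do rewrite ImD.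
  by apply: measurable_funD; exact/measurable_EFinP.
move=> x.
have -> : f x * g (c *: x) + - g 0 * f x = f x * (g (c *: x) - g 0) by ring.
rewrite cmodM; apply: (@le_trans _ _ (cmod (f x) * (L * (c * (1 + `|x|))))).
  rewrite ler_wpM2l ?cmod_ge0//; apply: le_trans (gL _) _; rewrite ler_wpM2l//.
  by rewrite normrZ (gtr0_norm c0) ler_wpM2l ?(ltW c0)// lerDr.
have A0 : 0 <= L * c by rewrite mulr_ge0// ltW.
have := ler_wpM2l A0 (@schwartz_weight_le _ _ f 1 x fS); rewrite expr1; congr (_ <= _); ring.
Qed.

(* Let c tend to 0 in \int ft 1 g x * k (c x) = \int ft 1 k x * g (c x), which is
   the multiplication formula after a dilation. *)
Lemma ft_exchange g k : schwartz g -> schwartz k ->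
  k 0 * cintegral (ft 1 g) = g 0 * cintegral (ft 1 k).
Proof.
move=> gS kS; have n1 := oner_neq0 R.
have gF := (sop_ft n1).1 _ gS; have kF := (sop_ft n1).1 _ kS.
have [K1 K1E] := cintegral_dilation_limit gF kS.
have [K2 K2E] := cintegral_dilation_limit kF gS.
have eqc c : 0 < c -> cintegral (fun x => ft 1 g x * k (c *: x)) =
    cintegral (fun x => ft 1 k x * g (c *: x)).
  move=> c0; have c0' : c != 0 by rewrite gt_eqF.
  have cV0 : c^-1 != 0 by rewrite invr_eq0.
  have := ft_mul_formula cV0 gS kS.
  (* Both sides of the multiplication formula acquire the same Jacobian under the dilation, and it
     cancels. *)
  have A (u v : E -> R[i]) : schwartz u -> schwartz v ->
      cintegral (fun x => ft c^-1 u x * v x) =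
      (`|c^-1|^-1 ^+ m)%:C * cintegral (fun x => ft 1 u x * v (c *: x)).
    move=> uS vS; rewrite -(cintegral_affine 0 cV0); last first.
      exact: (cintegral_dilation c0' ((sop_ft n1).1 _ uS) vS).
    apply: eq_cintegral => x; rewrite addr0 scalerA divff// scale1r.
    by rewrite ft_scale.
  rewrite A//.
  have -> : cintegral (fun eta => g eta * ft c^-1 k eta) =
      cintegral (fun eta => ft c^-1 k eta * g eta).
    by apply: eq_cintegral => x; rewrite mulrC.
  rewrite A//; apply: mulfI.
  by rewrite -cmod_eq0 cmod_real normr_eq0 expf_neq0// invr_eq0 normr_eq0.
apply/eqP; rewrite -subr_eq0 -cmod_eq0 eq_le cmod_ge0 andbT leNgt; apply/negP => d0.
set d := cmod _ in d0.
have H c : 0 < c -> d <= (K1 + K2) * c.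
  move=> c0; rewrite mulrDl.
  apply: le_trans (lerD (K1E _ c0) (K2E _ c0)).
  rewrite (eqc _ c0) -[X in X + _]cmodN.
  apply: le_trans (cmodD _ _).
  have alg (u v w : R[i]) : - (u - v) + (u - w) = v - w by ring.
  by rewrite alg.
have K0 : 0 < K1 + K2 by have := H 1 ltr01; lra.
have := H (d / (2 * (K1 + K2))); rewrite divr_gt0 ?mulr_gt0// => /(_ isT).
have -> : (K1 + K2) * (d / (2 * (K1 + K2))) = d / 2 by field; rewrite gt_eqF.
lra.
Qed.

Lemma ft_conj g xi : schwartz g ->
  ft 1 (fun x => conjc (g x)) xi = conjc (ft (-1) g xi).
Proof.
move=> gS; rewrite /ft -cintegral_conj; last exact/schwartz_cintegrable/schwartz_ft_kernel.
apply: eq_cintegral => x; rewrite [RHS]rmorphM [X in _ = _ * X]conj_expi.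
by rewrite scaleN1r scale1r dotNl opprK.
Qed.

Lemma cintegral_sqr_eq0 g : schwartz g ->
  cintegral (fun x => g x * conjc (g x)) = 0 -> forall x, g x = 0.
Proof.
move=> gS /(congr1 (@complex.Re R)) /= int0.
pose u x := complex.Re (g x * conjc (g x)).
have uE x : u x = cmod (g x) ^+ 2.
  rewrite /u; case: (g x) => a b; rewrite /cmod/= mulrN opprK sqr_sqrtr.
    by rewrite !expr2.
  by rewrite addr_ge0// sqr_ge0.
have uS : schwartz (fun x => g x * conjc (g x)).
  by apply: (sop_mul (slow_schwartz gS)).1; exact: schwartz_conj.
have [ui _] := schwartz_cintegrable uS.
have u0 : (\int[mu]_x (u x)%:E = 0)%E.
  rewrite -[LHS]fineK; last exact: (integrable_fin_num measurableT ui).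
  by rewrite [X in X%:E]int0.
have uc : forall x, {for x, continuous u} by case: (schwartz_ccontinuous uS).
have u_ge0 x : 0 <= u x by rewrite uE sqr_ge0.
move=> x; have := continuous_integral_eq0 uc u_ge0 u0 x.
by rewrite uE => /eqP; rewrite sqrf_eq0 cmod_eq0 => /eqP.
Qed.

Lemma ft_inversion_const g0 x0 : schwartz g0 -> g0 x0 != 0 ->
  exists C : R[i], C != 0 /\
    forall g, schwartz g -> forall xi, ft (-1) (ft 1 g) xi = C * g xi.
Proof.
move=> g0S g0x0; have n1 := oner_neq0 R.
(* Translated so that the nonzero value sits at the origin, where [ft_exchange] evaluates. *)
pose k x := g0 (x - (- x0)).
have kS : schwartz k by exact: (sop_shift _).1.
have k0 : k 0 != 0 by rewrite /k sub0r opprK.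
pose C := cintegral (ft 1 k) / k 0.
have CE g : schwartz g -> cintegral (ft 1 g) = C * g 0.
  move=> gS; apply: (mulfI k0); rewrite ft_exchange//.
  by rewrite /C [RHS]mulrCA [RHS]mulrA divfK// mulrC.
(* The formula at the origin is applied to the translate of [g] with value [g xi] there; its
   transform is that of [g] times the phase of frequency [xi]. *)
have inv g : schwartz g -> forall xi, ft (-1) (ft 1 g) xi = C * g xi.
  move=> gS xi.
  have hS : schwartz (heis (- xi) 0 0 g) by exact: schwartz_heis.
  have E0 : heis (- xi) 0 0 g 0 = g xi.
    by rewrite /heis dot0l addr0 expi0 mul1r sub0r opprK.
  rewrite -E0 -CE// ft_heis//; apply: eq_cintegral => x.
  rewrite /heis scaler0 subr0 dot0l add0r mulrC add0r.
  by rewrite !scaleN1r -dotNl.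
exists C; split => //; apply/eqP => C0.
have ft0 g : schwartz g -> forall xi, ft 1 g xi = 0.
  move=> gS xi; have FS := (sop_ft n1).1 _ gS.
  have cFS := schwartz_conj FS.
  have := ft_mul_formula n1 gS cFS.
  rewrite [RHS](_ : _ = cintegral (fun x => 0 * g x)); last first.
    apply: eq_cintegral => x; rewrite ft_conj// inv// C0 !mul0r.
    by rewrite (_ : conjc 0 = 0) ?mulr0//; exact: conjc0.
  rewrite cintegralZ; last exact: schwartz_cintegrable.
  by rewrite mul0r => /(cintegral_sqr_eq0 FS).
have gS : schwartz (fun x => g0 x * conjc (g0 x)).
  by apply: (sop_mul (slow_schwartz g0S)).1; exact: schwartz_conj.
(* This integral is the Fourier transform of the squared modulus of [g0] at frequency 0. *)
have gI : cintegral (fun x => g0 x * conjc (g0 x)) = 0.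
  rewrite -[RHS](ft0 _ gS 0); apply: eq_cintegral => x.
  by rewrite scaler0 dot0l oppr0 expi0 mulr1.
by move: g0x0; rewrite (cintegral_sqr_eq0 g0S gI) eqxx.
Qed.

End fourier_inversion.

(** * Mixed norms *)

Section mixed_norm_swap.
Local Open Scope complex_scope.
Context {R : realType} (m : nat).
Local Notation E := 'rV[R]_m.
Local Notation mu := (@lebesgue_rV R m).

Lemma ge0_integral_reflect (f : E -> \bar R) :
  measurable_fun [set: E] f -> (forall x, (0 <= f x)%E) ->
  (\int[mu]_x f (- x)%R = \int[mu]_x f x)%E.
Proof.
move=> mf f0; have := @ge0_integral_affine R m (-1) 0 f _ mf f0.
rewrite normrN1 invr1 expr1n mul1e oppr_eq0 oner_eq0 => /(_ isT) <-.
by apply: eq_integral => x _; rewrite scaleN1r addr0.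
Qed.

Lemma measurable_reflect2 (H : E * E -> \bar R) : measurable_fun [set: E * E] H ->
  measurable_fun [set: E * E] (fun z => H (z.1, - z.2)).
Proof.
move=> mH; apply: (measurableT_comp mH).
have mN : measurable_fun [set: E] (fun x : E => - x).
  have := measurable_rV_affine (-1) (0 : E).
  by under eq_fun do rewrite scaleN1r addr0.
apply/measurable_fun_pairP; split; first exact: measurable_fst.
exact: (measurableT_comp mN measurable_snd).
Qed.

Lemma ge0_integral_swap_reflect (H : E * E -> \bar R) :
  measurable_fun [set: E * E] H -> (forall z, (0 <= H z)%E) ->
  (\int[mu]_y \int[mu]_x H (y, - x)%R = \int[mu]_y \int[mu]_x H (x, y))%E.
Proof.
move=> mH H0; rewrite -(fubini_tonelli H mH H0).
apply: eq_integral => y _.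
apply: (@ge0_integral_reflect (fun x => H (y, x))) => //.
exact: (measurableT_comp mH (measurable_pair1 y)).
Qed.

Lemma ae_imply (P Q : E -> Prop) : (forall x, P x -> Q x) ->
  {ae mu, forall x, P x} -> {ae mu, forall x, Q x}.
Proof. by move=> PQ; apply: filterS. Qed.

Lemma ge0_integral_eq0 (f : E -> \bar R) :
  measurable_fun [set: E] f -> (forall x, (0 <= f x)%E) ->
  (\int[mu]_x f x = 0)%E <-> {ae mu, forall x, f x = 0%E}.
Proof.
move=> mf f0.
have -> : (\int[mu]_x f x = \int[mu]_x `|f x|)%E.
  by apply: eq_integral => x _; rewrite gee0_abs.
split=> [/(ae_eq_integral_abs _ measurableT mf)|f0'].
  by apply: filterS => x; exact.
by apply/(ae_eq_integral_abs _ measurableT mf); apply: filterS f0' => x.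
Qed.

Lemma ess_sup_le_lty (u : E -> \bar R) : (ess_sup mu (abse \o u) < +oo)%E ->
  exists M : R, {ae mu, forall x, (`|u x| <= M%:E)%E}.
Proof.
move=> uoo.
have [M uM] : exists M : R, (ess_sup mu (abse \o u) <= M%:E)%E.
  case E1 : (ess_sup _ _) uoo => [r| |] // _; [by exists r|by exists 0; rewrite leNye].
by exists M; exact/ess_supP.
Qed.

Lemma Lnorm_pinfty (u : E -> \bar R) : Lnorm mu +oo%E u =
  if (0 < mu [set: E])%E then ess_sup mu (abse \o u) else 0%E.
Proof. by rewrite unlock. Qed.

Lemma mixed_norm_swap_reflect (p : \bar R) (k : R) (F F' : E -> E -> R[i]) :
  (1 <= p)%E -> 0 <= k ->
  measurable_fun [set: E * E] (fun z => cmod (F z.1 z.2)) ->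
  (forall xi eta, cmod (F' xi eta) = k * cmod (F eta (- xi))) ->
  (mixed_norm p p F < +oo)%E -> (mixed_norm p p F' < +oo)%E.
Proof.
case: p => [r| |]// p1 k0 mF FF'.
- have r0 : r != 0 by move: p1; rewrite lee_fin => r1; rewrite gt_eqF// (lt_le_trans ltr01).
  pose H z : \bar R := (cmod (F z.1 z.2) `^ r)%:E.
  have mH : measurable_fun [set: E * E] H.
    by apply/measurable_EFinP; exact: (measurableT_comp (measurable_powR r) mF).
  have H0 z : (0 <= H z)%E by rewrite lee_fin powR_ge0.
  (* With equal exponents both roots disappear in the [r]-th power, leaving an iterated integral to
     which Tonelli applies. *)
  have NE (G : E -> E -> R[i]) : (mixed_norm r%:E r%:E G `^ r =
      \int[mu]_y \int[mu]_x (cmod (G x y) `^ r)%:E)%E.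
    rewrite /mixed_norm (poweR_Lnorm _ _ r0); apply: eq_integral => y _.
    rewrite gee0_abs; last exact: Lnorm_ge0.
    rewrite (poweR_Lnorm _ _ r0); apply: eq_integral => x _.
    by rewrite gee0_abs// lee_fin cmod_ge0.
  move=> /(@poweR_lty _ _ r) Foo; apply: (lty_poweRy r0); move: Foo; rewrite !NE => Foo.
  have -> : (\int[mu]_y \int[mu]_x (cmod (F' x y) `^ r)%:E =
      (k `^ r)%:E * \int[mu]_y \int[mu]_x H (y, - x)%R)%E.
    have mHr := measurable_reflect2 mH.
    have mHry y : measurable_fun [set: E] (fun x => H (y, - x)).
      exact: (measurableT_comp mHr (measurable_pair1 y)).
    rewrite -ge0_integralZl//; last 3 first.
    + exact: (@measurable_fun_fubini_tonelli_F _ _ _ _ _ mu _ mHr (fun z => H0 _)).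
    + by move=> y _; exact: integral_ge0.
    + by rewrite lee_fin powR_ge0.
    apply: eq_integral => y _; rewrite -ge0_integralZl ?lee_fin ?powR_ge0//.
    by apply: eq_integral => x _; rewrite FF' powRM ?cmod_ge0// EFinM.
  by rewrite ge0_integral_swap_reflect// lte_mul_pinfty// lee_fin powR_ge0.
- rewrite /mixed_norm !Lnorm_pinfty; case: ifPn => // mu0.
  have NE (G : E -> E -> R[i]) :
      (fun eta => Lnorm mu +oo%E (fun xi => (cmod (G xi eta))%:E)) =
      (fun eta => ess_sup mu (abse \o (fun xi => (cmod (G xi eta))%:E))).
    by apply/funext => eta; rewrite Lnorm_pinfty mu0.
  rewrite !NE.
  move=> /ess_sup_le_lty[M FM].
  (* Almost every section of this superlevel set is null, so the iterated integral of its indicator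
     vanishes. In that form the condition survives the exchange of variables, and reading it back
     gives the bound [k * M] for [F']. *)
  pose A : set (E * E) := [set z | M < cmod (F z.1 z.2)].
  have mA : measurable A.
    rewrite /A -[X in measurable X]setTI.
    rewrite (_ : [set z | _] = (fun z => cmod (F z.1 z.2)) @^-1` `]M, +oo[).
      exact: mF.
    by apply/seteqP; split => z /=; rewrite in_itv/= andbT.
  pose H z : \bar R := (\1_A z)%:E.
  have mH : measurable_fun [set: E * E] H by apply/measurable_EFinP; exact: measurable_indic.
  have H0 z : (0 <= H z)%E by rewrite lee_fin.
  have int0 : (\int[mu]_y \int[mu]_x H (x, y) = 0)%E.
    apply/ge0_integral_eq0.
    - exact: (measurable_fun_fubini_tonelli_G H).
    - by move=> y; exact: integral_ge0.
    apply: ae_imply FM => y /(le_trans (lee_abs _))/ess_supP Fy.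
    apply/ge0_integral_eq0 => //.
      exact: (measurableT_comp mH (measurable_pair2 y)).
    apply: ae_imply Fy => x /=; rewrite lee_fin ger0_norm ?cmod_ge0// => Fxy.
    by rewrite /H indicE memNset//= /A/= => /(le_lt_trans Fxy); rewrite ltxx.
  have := ge0_integral_swap_reflect mH H0; rewrite int0.
  have mHr := measurable_reflect2 mH.
  have mHrF := @measurable_fun_fubini_tonelli_F _ _ _ _ _ mu _ mHr (fun z => H0 _).
  have iH (y : E) : (0 <= fubini_F mu (fun z : E * E => H (z.1, - z.2)%R) y)%E by exact: integral_ge0.
  move/(ge0_integral_eq0 mHrF iH) => ae0.
  suff : (ess_sup mu (abse \o (fun y => ess_sup mu (abse \o (fun x => (cmod (F' x y))%:E)))) <= (k * M)%:E)%E.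
    by move=> /le_lt_trans -> //; rewrite ltry.
  apply/ess_supP; apply: ae_imply ae0 => y /= Hy.
  have mHry : measurable_fun [set: E] (fun x => H (y, - x)).
    exact: (measurableT_comp mHr (measurable_pair1 y)).
  rewrite gee0_abs; last first.
    by apply: (ess_sup_gee mu0); apply: nearW => x /=; rewrite lee_fin.
  apply/ess_supP; move/(ge0_integral_eq0 mHry (fun=> H0 _)): Hy => aex.
  apply: ae_imply aex => x.
  move=> /= Hxy; rewrite lee_fin ger0_norm ?cmod_ge0// FF' ler_wpM2l// leNgt.
  apply/negP => MF; move: Hxy; rewrite /H indicE mem_set// => -[] /eqP.
  by rewrite oner_eq0.
Qed.

End mixed_norm_swap.

(** * Twisted modulation spaces *)

Section twisted_operators.
Local Open Scope complex_scope.
Context {R : realType} (n : nat) (lam : R).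
Local Notation E := 'rV[R]_(n + n).
Implicit Types (xi eta zeta x p q : E) (g : E -> R[i]).

(** The matrix of the symplectic form, which turns the twisted phase and the twisted translation
    vector into data for [heis]. *)
Definition symplectic_J x : E := row_mx (rsubmx x) (- lsubmx x).

Lemma dot_row_mx (a b c d : 'rV[R]_n) :
  dot (row_mx a b) (row_mx c d) = dot a c + dot b d.
Proof.
rewrite /dot big_split_ord/=; congr (_ + _); apply: eq_bigr => i _.
  by rewrite !row_mxEl.
by rewrite !row_mxEr.
Qed.

Lemma symplectic_JZ a x : a *: symplectic_J x = symplectic_J (a *: x).
Proof.
rewrite /symplectic_J scale_row_mx scalerN; congr (row_mx _ (- _)).
  by apply/rowP => i; rewrite !mxE.
by apply/rowP => i; rewrite !mxE.
Qed.

Lemma symplectic_JN x : symplectic_J (- x) = - symplectic_J x.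
Proof. by rewrite -[in RHS]scaleN1r symplectic_JZ scaleN1r. Qed.

Lemma dot_symplectic x y : dot (symplectic_J y) x = - symp x y.
Proof.
rewrite -[in LHS](hsubmxK x) /symplectic_J dot_row_mx dotNl /symp opprB.
by rewrite [dot (lsubmx y) _]dotC.
Qed.

Lemma twisted_translationE eta g :
  twisted_translation lam eta g = heis eta ((lam / 2) *: symplectic_J eta) 0 g.
Proof.
apply/funext => x; rewrite /twisted_translation /heis mulrC add0r dotZl.
by rewrite dot_symplectic mulrN.
Qed.

Lemma twisted_modulationE eta g : twisted_modulation lam eta g =
  heis (tanh (lam / 2) *: symplectic_J eta) (- clam lam *: eta) 0 g.
Proof.
apply/funext => x; rewrite /twisted_modulation /heis mulrC add0r; congr (expi _ * g _).
  rewrite dotZl mulNr; congr (- (_ * _)).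
  by rewrite -[in RHS](hsubmxK x) -[in RHS](hsubmxK eta) dot_row_mx
    [dot (lsubmx x) _]dotC [dot (rsubmx x) _]dotC.
rewrite -[in RHS](hsubmxK x) /symplectic_J scale_row_mx opp_row_mx add_row_mx.
by rewrite scalerN opprK.
Qed.

Lemma twisted_shiftE xi eta g : twisted_shift lam xi eta g =
  heis (tanh (lam / 2) *: symplectic_J eta + xi)
    (- clam lam *: eta + (lam / 2) *: symplectic_J xi)
    (lam / 2 * coth lam * dot xi eta -
      dot ((lam / 2) *: symplectic_J xi) (tanh (lam / 2) *: symplectic_J eta)) g.
Proof.
apply/funext => x.
rewrite /twisted_shift twisted_modulationE twisted_translationE heis_comp heis_phase.
by rewrite add0r add0r.
Qed.

Lemma sinh_neq0 (s : R) : s != 0 -> sinh s != 0.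
Proof.
apply: contra; rewrite /sinh mulf_eq0 invr_eq0 pnatr_eq0 orbF subr_eq0.
by move=> /eqP /expR_inj h; apply/eqP; lra.
Qed.

Lemma cosh_gt0 (s : R) : 0 < cosh s.
Proof. by rewrite /cosh divr_gt0// addr_gt0// expR_gt0. Qed.

Hypothesis lam0 : lam != 0.

Let lam20 : lam / 2 != 0. Proof. by rewrite mulf_neq0// invr_eq0 pnatr_eq0. Qed.

Lemma clam_neq0 : clam lam != 0.
Proof.
rewrite /clam /coth mulf_neq0// mulf_neq0 ?invr_eq0 ?sinh_neq0//.
by rewrite gt_eqF// cosh_gt0.
Qed.

(** The compatibility between the dilation in the twisted Fourier transform and the coefficients of
    [twisted_shift]. *)
Lemma clam_tanh : clam lam * tanh (lam / 2) = lam / 2.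
Proof.
rewrite /clam /coth /tanh; field.
by rewrite sinh_neq0// gt_eqF// cosh_gt0.
Qed.

Definition fourier_scalar : R[i] := (clam lam ^+ n)%:C * (((2 * pi) ^+ n)^-1)%:C.

Lemma fourier_scalar_neq0 : fourier_scalar != 0.
Proof.
rewrite /fourier_scalar mulf_neq0// -cmod_eq0 cmod_real normr_eq0 ?invr_eq0 expf_neq0 ?clam_neq0//.
by rewrite mulf_neq0// gt_eqF// pi_gt0.
Qed.

Lemma twisted_fourierE g : twisted_fourier lam g =
  fun x => fourier_scalar * ft (clam lam) g x.
Proof. by apply/funext => x; rewrite /twisted_fourier /fourier mulrA. Qed.

(** The reflection in the adjoint becomes a sign on the dilation parameter, so [ft_heis] and
    [sop_ft] apply to it directly. *)
Lemma twisted_fourier_reflectE g : (fun x => twisted_fourier lam g (- x)) =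
  fun x => fourier_scalar * ft (- clam lam) g x.
Proof.
apply/funext => x; rewrite twisted_fourierE /ft; congr (_ * _).
by apply: eq_cintegral => y; rewrite scalerN scaleNr.
Qed.

End twisted_operators.

(** * Invariance under twisted translations and modulations *)

Section invariance.
Local Open Scope complex_scope.
Context {R : realType} (n : nat) (lam : R) (p q : \bar R).
Local Notation E := 'rV[R]_(n + n).
Implicit Types (xi eta : E) (f : @functional R (n + n)) (g : E -> R[i]).

Lemma measurable_J d (T : measurableType d) (h : T -> E) (i : 'I_(n + n)) :
  (forall j, measurable_fun [set: T] (fun t => h t ord0 j)) ->
  measurable_fun [set: T] (fun t => symplectic_J (h t) ord0 i).
Proof.
move=> mh; rewrite /symplectic_J; case: (split_ordP i) => j ->.
  by under eq_fun do rewrite row_mxEl mxE; exact: mh.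
by under eq_fun do rewrite row_mxEr !mxE; apply: measurableT_comp => //; exact: mh.
Qed.

Lemma measurable_coordD d (T : measurableType d) (h k : T -> E) (i : 'I_(n + n)) :
  measurable_fun [set: T] (fun t => h t ord0 i) ->
  measurable_fun [set: T] (fun t => k t ord0 i) ->
  measurable_fun [set: T] (fun t => (h t + k t) ord0 i).
Proof. by move=> mh mk; under eq_fun do rewrite mxE; exact: measurable_funD. Qed.

Lemma measurable_coordZ d (T : measurableType d) (h : T -> E) (a : R) (i : 'I_(n + n)) :
  measurable_fun [set: T] (fun t => h t ord0 i) ->
  measurable_fun [set: T] (fun t => (a *: h t) ord0 i).
Proof. by move=> mh; under eq_fun do rewrite mxE; exact: measurable_funM. Qed.

Lemma measurable_coordN d (T : measurableType d) (h : T -> E) (i : 'I_(n + n)) :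
  measurable_fun [set: T] (fun t => h t ord0 i) ->
  measurable_fun [set: T] (fun t => (- h t) ord0 i).
Proof. by move=> mh; under eq_fun do rewrite mxE; exact: measurableT_comp. Qed.

Lemma measurable_fst_coord (i : 'I_(n + n)) :
  measurable_fun [set: E * E] (fun z => z.1 ord0 i).
Proof. exact: (measurableT_comp (measurable_coord i) measurable_fst). Qed.

Lemma measurable_snd_coord (i : 'I_(n + n)) :
  measurable_fun [set: E * E] (fun z => z.2 ord0 i).
Proof. exact: (measurableT_comp (measurable_coord i) measurable_snd). Qed.

Lemma schwartz_twisted_shift xi eta g : schwartz g ->
  schwartz (twisted_shift lam xi eta g).
Proof. by move=> gS; rewrite twisted_shiftE; exact: schwartz_heis. Qed.

Lemma eq_mixed_norm (F G : E -> E -> R[i]) :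
  (forall xi eta, cmod (F xi eta) = cmod (G xi eta)) ->
  mixed_norm p q F = mixed_norm p q G.
Proof.
move=> FG; rewrite /mixed_norm; congr Lnorm; apply/funext => eta.
by congr Lnorm; apply/funext => xi; rewrite FG.
Qed.

(* Heisenberg operators commute up to a phase, so the operator can be absorbed
   in the window. *)
Lemma modulation_space_heis p0 q0 f : twisted_modulation_space lam p q f ->
  twisted_modulation_space lam p q (ext_by_adjoint (heis (- p0) (- q0) 0) f).
Proof.
move=> [ft [g [gS [x0 gx0] [mRe mIm Foo]]]].
have g'S : schwartz (heis p0 q0 0 g) by exact: schwartz_heis.
split.
  apply: tempered_ext => //; first exact: sop_heis.
  by move=> a h k _ _; apply/funext => x; rewrite /heis mulrDr mulrCA.
exists (heis p0 q0 0 g); split => //.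
  by exists (x0 + p0); rewrite /heis addrK mulf_neq0// expi_neq0.
pose P (z : E * E) := tanh (lam / 2) *: symplectic_J z.2 + z.1.
pose Q (z : E * E) := - clam lam *: z.2 + (lam / 2) *: symplectic_J z.1.
(* The commutator phase, read off from two uses of [heis_comp]. *)
pose b z := dot q0 p0 - dot q0 (P z) + dot (Q z) p0.
have E1 xi eta : bracket (ext_by_adjoint (heis (- p0) (- q0) 0) f)
    (twisted_shift lam xi eta (heis p0 q0 0 g)) =
    expi (- b (xi, eta)) * bracket f (twisted_shift lam xi eta g).
  rewrite bracket_ext -conj_expi -bracket_scale//; last exact: schwartz_twisted_shift.
  congr (bracket f _); rewrite !twisted_shiftE !heis_comp.
  rewrite -[tanh _ *: _ + _]/(P (xi, eta)) -[_ + _ *: symplectic_J _]/(Q (xi, eta)).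
  apply/funext => x; rewrite heis_phase /heis; congr (expi (_ + dot _ x) * g (x - _)).
  - by rewrite /b !dotDr !dotNr; ring.
  - by rewrite addrAC addNr add0r.
  - by rewrite addrAC addNr add0r.
(* [mixed_Lebesgue] asks for measurable real and imaginary parts, so equality of moduli does not
   suffice and the phase itself must be measurable. *)
have mb : measurable_fun [set: E * E] (fun z => - b z).
  have mP i : measurable_fun [set: E * E] (fun z => P z ord0 i).
    apply: measurable_coordD; last exact: measurable_fst_coord.
    apply/measurable_coordZ/measurable_J; exact: measurable_snd_coord.
  have mQ i : measurable_fun [set: E * E] (fun z => Q z ord0 i).
    apply: measurable_coordD.
      by apply: measurable_coordZ; exact: measurable_snd_coord.
    apply/measurable_coordZ/measurable_J; exact: measurable_fst_coord.
  apply: measurableT_comp => //; apply: measurable_funD.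
    by apply: measurable_funB => //; exact: measurable_dot.
  exact: measurable_dot.
have [m1 m2] := cmeasurableM (cmeasurable_expi mb) (conj mRe mIm).
split.
- by under eq_fun do rewrite E1; exact: m1.
- by under eq_fun do rewrite E1; exact: m2.
- rewrite (eq_mixed_norm (G := fun xi eta => bracket f (twisted_shift lam xi eta g)))//.
  by move=> xi eta; rewrite E1 cmodM cmod_expi mul1r.
Qed.

End invariance.

(** * Invariance under the twisted Fourier transform *)

Section fourier_invariance.
Local Open Scope complex_scope.
Context {R : realType} (n : nat) (lam : R).
Local Notation E := 'rV[R]_(n + n).
Local Notation c := (clam lam).
Local Notation t := (tanh (lam / 2)).
Local Notation J := symplectic_J.

(** The case of general [a] is the case 1 after dilating the frequency variable, at the cost of a
    Jacobian in the constant. *)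
Lemma ft_inversion m (a : R) (g : 'rV[R]_m -> R[i]) x0 : a != 0 ->
  schwartz g -> g x0 != 0 ->
  exists C : R[i], C != 0 /\ forall x, ft (- a) (ft a g) x = C * g x.
Proof.
move=> a0 gS gx0; have [C [C0 inv]] := ft_inversion_const gS gx0.
exists ((`|a|^-1 ^+ m)%:C * C); split=> [|x].
  by rewrite mulf_neq0// -cmod_eq0 cmod_real normr_eq0 expf_neq0// invr_eq0 normr_eq0.
have FS := (sop_ft m (oner_neq0 R)).1 _ gS.
rewrite -mulrA -inv// /ft -(cintegral_affine 0 a0); last first.
  exact/schwartz_cintegrable/schwartz_ft_kernel.
apply: eq_cintegral => y; rewrite addr0 scale1r -/(ft _ _ _).
by rewrite scaleN1r scaleNr !dotNl dotZl dotZr.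
Qed.

Lemma modulation_space_fourier (p : \bar R) (f : functional (n + n)) :
  lam != 0 -> (1 <= p)%E -> twisted_modulation_space lam p p f ->
  twisted_modulation_space lam p p (dtwisted_fourier lam f).
Proof.
move=> lam0 p1 [ft0 [g0 [g0S [x0 gx0] [mRe mIm Foo]]]].
have c0 := clam_neq0 lam0; have ct := clam_tanh lam0.
have cN0 : - c != 0 by rewrite oppr_eq0.
set S := fun (g : E -> R[i]) xi => twisted_fourier lam g (- xi).
pose k := fourier_scalar n lam.
have SE : S = fun g x => k * ft (- c) g x.
  by apply/funext => g; exact: twisted_fourier_reflectE.
have Ssop : sop S by rewrite SE; exact: (sop_comp (sop_scale _ k) (sop_ft _ cN0)).
have Slin : clinear_on_schwartz S.
  by move=> a g h gS hS; rewrite SE ft_clinear//; apply/funext => x; ring.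
have [C [C0 inv]] := ft_inversion c0 g0S gx0.
pose g := twisted_fourier lam g0.
have gE : g = fun x => k * ft c g0 x by exact: twisted_fourierE.
have FgS := (sop_ft _ c0).1 _ g0S.
have gS : schwartz g by rewrite gE; exact: (sop_scale _ k).1.
pose K := k * k * C.
have k0 : k != 0 by exact: fourier_scalar_neq0.
have K0 : K != 0 by rewrite /K mulf_neq0// mulf_neq0.
have SgE x : S g x = K * g0 x.
  rewrite SE gE; have -> : ft (- c) (fun x => k * ft c g0 x) x = k * (C * g0 x).
    rewrite -inv /ft -cintegralZ; last exact/schwartz_cintegrable/schwartz_ft_kernel.
    by apply: eq_cintegral => y; rewrite mulrA.
  by rewrite /K !mulrA.
(* A window that vanished identically would make [S g], hence the nonzero multiple [K * g0], vanish
   at [x0]. *)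
have gneq0 : exists x, g x != 0.
  apply: contrapT => /forallNP g00.
  have : S g x0 = 0.
    rewrite SE /ft (@eq_cintegral _ _ _ (fun y => 0 * g0 y)) => [|y].
      by rewrite cintegralZ ?mul0r ?mulr0//; exact: schwartz_cintegrable.
    by have /negP/negPn/eqP -> := g00 y; rewrite !mul0r.
  by move/eqP; rewrite SgE mulf_eq0 (negbTE K0) (negbTE gx0).
pose al (x y : E) := lam / 2 * coth lam * dot x y - dot ((lam / 2) *: J x) (t *: J y).
pose P (z : E * E) := t *: J z.2 + z.1.
pose Q (z : E * E) := - c *: z.2 + (lam / 2) *: J z.1.
(* The phase of the original shift, plus the term from [ft_heis], minus the phase already contained
   in the target shift by (eta, -xi). *)
pose b z := al z.1 z.2 + dot (Q z) (P z) - al z.2 (- z.1).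
have SPi xi eta : S (twisted_shift lam xi eta g) =
    fun x => K * expi (b (xi, eta)) * twisted_shift lam eta (- xi) g0 x.
  rewrite SE !twisted_shiftE -/(al xi eta) -/(al eta (- xi)).
  rewrite -[tanh _ *: _ + _]/(P (xi, eta)) -[_ + _ *: J _]/(Q (xi, eta)).
  rewrite ft_heis//.
  apply/funext => x.
  (* By [clam_tanh], dividing [lam / 2] by [- c] yields [- t], so the frequency becomes the
     translation part of the target shift; the next identity is its mirror image. *)
  have -> : (- c)^-1 *: Q (xi, eta) = t *: J (- xi) + eta.
    have cV : (- c)^-1 * (lam / 2) = - t.
      by rewrite -[X in _ * X]ct invrN mulNr mulKf.
    rewrite /Q/= scalerDr !scalerA mulVf// scale1r cV addrC.
    by rewrite symplectic_JN scalerN scaleNr.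
  have -> : - - c *: P (xi, eta) = - c *: - xi + (lam / 2) *: J eta.
    by rewrite /P/= opprK scalerDr scalerA ct scaleNr scalerN opprK addrC.
  have SgE' y : ft (- c) g y = k^-1 * (K * g0 y).
    by rewrite -SgE SE mulKf.
  rewrite -mulrA heis_phase /b/= subrK /heis SgE'.
  by rewrite /=; field.
have E1 xi eta : bracket (dtwisted_fourier lam f) (twisted_shift lam xi eta g) =
    conjc K * expi (- b (xi, eta)) * bracket f (twisted_shift lam eta (- xi) g0).
  rewrite [LHS](bracket_ext S) SPi bracket_scale//; last exact: schwartz_twisted_shift.
  by rewrite -conj_expi [X in X * _ = _]rmorphM.
have mJ1 i : measurable_fun [set: E * E] (fun z => J z.1 ord0 i).
  by apply: measurable_J => j; exact: measurable_fst_coord.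
have mJ2 i : measurable_fun [set: E * E] (fun z => J z.2 ord0 i).
  by apply: measurable_J => j; exact: measurable_snd_coord.
have mJN i : measurable_fun [set: E * E] (fun z => J (- z.1) ord0 i).
  by apply: measurable_J => j; apply: measurable_coordN; exact: measurable_fst_coord.
have mb : measurable_fun [set: E * E] (fun z => - b z).
  apply: measurableT_comp => //; apply: measurable_funB.
    apply: measurable_funD.
      apply: measurable_funB.
        apply: measurable_funM => //; apply: measurable_dot => i.
          exact: measurable_fst_coord.
        exact: measurable_snd_coord.
      by apply: measurable_dot => i; exact: measurable_coordZ.
    apply: measurable_dot => i; apply: measurable_coordD.
    - by apply: measurable_coordZ; exact: measurable_snd_coord.
    - exact: measurable_coordZ.
    - exact: measurable_coordZ.
    - exact: measurable_fst_coord.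
  apply: measurable_funB.
    apply: measurable_funM => //; apply: measurable_dot => i.
      exact: measurable_snd_coord.
    by apply: measurable_coordN; exact: measurable_fst_coord.
  by apply: measurable_dot => i; exact: measurable_coordZ.
have mrot : measurable_fun [set: E * E] (fun z : E * E => (z.2, - z.1)).
  apply/measurable_fun_pairP; split; first exact: measurable_snd.
  apply: measurable_fun_rV => i /=.
  by apply: measurable_coordN; exact: measurable_fst_coord.
have mF : cmeasurable (fun z : E * E => bracket f (twisted_shift lam z.1 z.2 g0)) by [].
have mFr : cmeasurable (fun z : E * E => bracket f (twisted_shift lam z.2 (- z.1) g0)).
  by split; [exact: (measurableT_comp mRe mrot)|exact: (measurableT_comp mIm mrot)].
have mK : cmeasurable (fun z : E * E => conjc K) by split; exact: measurable_cst.
have [m1 m2] := cmeasurableM (cmeasurableM mK (cmeasurable_expi mb)) mFr.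
split; first exact: tempered_ext.
exists g; split => //; split.
- by under eq_fun do rewrite E1; exact: m1.
- by under eq_fun do rewrite E1; exact: m2.
- apply: (@mixed_norm_swap_reflect _ _ p (cmod K)) Foo => //.
  + exact: cmod_ge0.
  + exact: cmeasurable_cmod mF.
  + move=> xi eta; rewrite E1 [LHS]cmodM [X in X * _]cmodM cmod_expi mulr1.
    by rewrite cmod_conj.
Qed.

End fourier_invariance.

Theorem theorem3p8 (R : realType) (n : nat) (lam : R) (p q : \bar R)
    (lam_neq0 : lam != 0) (p_ge1 : (1 <= p)%E) (q_ge1 : (1 <= q)%E) :
  (forall (xi : 'rV[R]_(n + n)) (f : functional (n + n)),
     twisted_modulation_space lam p q f ->
     twisted_modulation_space lam p q (dtwisted_translation lam xi f)) /\
  (forall (eta : 'rV[R]_(n + n)) (f : functional (n + n)),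
     twisted_modulation_space lam p q f ->
     twisted_modulation_space lam p q (dtwisted_modulation lam eta f)) /\
  (p = q -> forall f : functional (n + n),
     twisted_modulation_space lam p q f ->
     twisted_modulation_space lam p q (dtwisted_fourier lam f)).
Proof.
split=> [xi f fM|].
  rewrite /dtwisted_translation.
  have -> : twisted_translation lam (- xi) =
      heis (- xi) (- ((lam / 2) *: symplectic_J xi)) 0.
    by apply/funext => g; rewrite twisted_translationE symplectic_JN scalerN.
  exact: modulation_space_heis.
split=> [eta f fM|<- f fM]; last exact: modulation_space_fourier.
rewrite /dtwisted_modulation.
have -> : twisted_modulation lam (- eta) =
    heis (- (tanh (lam / 2) *: symplectic_J eta)) (- (- clam lam *: eta)) 0.
  by apply/funext => g; rewrite twisted_modulationE symplectic_JN !scalerN.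
exact: modulation_space_heis.
Qed.
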